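(* There is an algorithm that, given a QBF $\varphi=Q_1S_1\dots\exists S_{\ell-1}\forall S_\ell.\,\psi$ and a tree decomposition of width $k$ of its primal graph $G_\varphi$, outputs in time $O^*(2^k)$ a QBF $\varphi'=Q_1S_1\dots\exists S'_{\ell-1}.\,\psi'$ (with the blocks before $S_{\ell-1}$ unchanged) and a tree decomposition of width $12\cdot 2^k$ of $G_{\varphi'}$ such that $\varphi$ is valid if and only if $\varphi'$ is valid.
   Context: QBFs are fully quantified and in prenex normal form, $Q_1S_1\dots Q_\ell S_\ell.\,\psi$, where the $S_i$ are disjoint sets of propositional variables, $Q_i\in\{\exists,\forall\}$, and the quantifier-free matrix $\psi$ is a CNF if the innermost quantifier is existential and a DNF if it is universal. So here $\psi$ is a DNF and $\psi'$ is a CNF. A QBF is valid if it evaluates to true. The primal graph $G_\varphi$ has as vertices the variables of the matrix, with an edge between two variables occurring together in a clause (or term). The width of a tree decomposition is the maximum bag size minus one. $O^*(\cdot)$ hides factors polynomial in the input size. *)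

(* Defs.v *)
(* Plain MathComp. *)
From mathcomp Require Import all_boot.

Set Implicit Arguments.
Unset Strict Implicit.
Unset Printing Implicit Defensive.

(** * Quantified Boolean formulas *)

(* Variables are identifiers over {0,1}, so that the length of their names is
   part of the input size. *)
Definition var := seq bool.

Definition assignment := var -> bool.

Definition literal := (bool * var)%type. (* (true, x) is x, (false, x) is ~x *)

Definition lit_true (a : assignment) (l : literal) : bool := a l.2 == l.1.

(* A list of clauses or a list of terms, depending on the prefix: see
   [matrix_true]. *)
Definition matrix := seq (seq literal).

Inductive quantifier := Exists | Forall.

Definition block := (quantifier * seq var)%type.

Record qbf := QBF { qbf_prefix : seq block; qbf_matrix : matrix }.

Definition cnf_true (a : assignment) (psi : matrix) : bool :=
  all (has (lit_true a)) psi.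

Definition dnf_true (a : assignment) (psi : matrix) : bool :=
  has (all (lit_true a)) psi.

(* The matrix is a CNF if the innermost quantifier is existential and a DNF if
   it is universal; the default of [last] is only seen by an empty prefix. *)
Definition matrix_true (phi : qbf) (a : assignment) : bool :=
  match (last (Exists, [::]) (qbf_prefix phi)).1 with
  | Exists => cnf_true a (qbf_matrix phi)
  | Forall => dnf_true a (qbf_matrix phi)
  end.

Definition override (a b : assignment) (X : seq var) : assignment :=
  fun x => if x \in X then b x else a x.

Fixpoint prefix_true (pre : seq block) (body : assignment -> Prop)
    (a : assignment) : Prop :=
  match pre with
  | [::] => body a
  | (Exists, X) :: pre' =>
      exists b : assignment, prefix_true pre' body (override a b X)
  | (Forall, X) :: pre' =>
      forall b : assignment, prefix_true pre' body (override a b X)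
  end.

(* The initial assignment is irrelevant for fully quantified formulas. *)
Definition qbf_valid (phi : qbf) : Prop :=
  prefix_true (qbf_prefix phi) (matrix_true phi) (fun _ => false).

Definition matrix_vars (psi : matrix) : seq var :=
  undup (flatten (map (map snd) psi)).

(* Blocks are duplicate-free, pairwise disjoint lists, and every variable of
   the matrix is quantified. *)
Definition qbf_wf (phi : qbf) : Prop :=
  uniq (flatten (map snd (qbf_prefix phi))) /\
  {subset matrix_vars (qbf_matrix phi) <= flatten (map snd (qbf_prefix phi))}.

(** * Primal graphs and tree decompositions *)

Record graph := Graph { vertices : seq var; edge : rel var }.

Definition primal_graph (phi : qbf) : graph :=
  Graph (matrix_vars (qbf_matrix phi))
    (fun x y => (x != y) &&
       has (fun c : seq literal => (x \in map snd c) && (y \in map snd c))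
           (qbf_matrix phi)).

(* A tree (with an arbitrary node chosen as root) whose nodes carry bags. *)
Inductive bagtree := Node (bag : seq var) (children : seq bagtree).

Fixpoint bags (t : bagtree) : seq (seq var) :=
  let: Node b ts := t in b :: flatten (map bags ts).

(* Nodes are addressed by the list of child indices leading to them from the
   root; [bag_at t p] is [None] if [t] has no node at address [p]. *)
Fixpoint bag_at (t : bagtree) (p : seq nat) : option (seq var) :=
  let: Node b ts := t in
  match p with
  | [::] => Some b
  | i :: p' => if onth ts i is Some t' then bag_at t' p' else None
  end.

Definition child_of (p q : seq nat) : bool :=
  prefix p q && (size q == (size p).+1).

Definition node_adj (p q : seq nat) : bool := child_of p q || child_of q p.

Definition node_has (t : bagtree) (x : var) (p : seq nat) : bool :=
  if bag_at t p is Some b then x \in b else false.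

(* The nodes whose bag contains [x] induce a connected subgraph of the tree. *)
Definition occurrences_connected (t : bagtree) (x : var) : Prop :=
  forall p q : seq nat, node_has t x p -> node_has t x q ->
  exists s : seq (seq nat),
    [/\ path node_adj p s, last p s = q & all (node_has t x) s].

Record tree_decomposition (G : graph) (t : bagtree) : Prop := {
  td_bags : forall b, b \in bags t -> uniq b /\ {subset b <= vertices G};
  td_vertices : forall x, x \in vertices G -> exists2 b, b \in bags t & x \in b;
  td_edges : forall x y, x \in vertices G -> y \in vertices G -> edge G x y ->
    exists2 b, b \in bags t & (x \in b) && (y \in b);
  td_connected : forall x, x \in vertices G -> occurrences_connected t x
}.

(* Truncated: if all bags are empty, this is 0 instead of -1. *)
Definition width (t : bagtree) : nat := (\max_(b <- bags t) size b).-1.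

(** * Algorithms and their running time

   Algorithms are programs of first-order pure LISP: data are binary trees,
   the primitives are construction and case analysis of a tree, and programs
   are finite systems of mutually recursive functions.  Every evaluation step
   has unit cost.  As data are immutable, a tree is implemented by a pointer and
   every step takes constant time on a RAM; conversely, memory organized as a
   balanced search tree simulates a RAM with an overhead logarithmic in the
   running time.  Hence time bounds f(k) * poly(n) with log f(k) polynomial in
   n do not depend on which of the two models is used. *)

Inductive data := Leaf | Pair (d1 d2 : data).

Fixpoint data_size (d : data) : nat :=
  match d with
  | Leaf => 1
  | Pair d1 d2 => (data_size d1 + data_size d2).+1
  end.

(* Variables are de Bruijn indices.  [ECase e e0 e1] continues with [e0] if the
   value of [e] is [Leaf], and with [e1] in the environment extended by [d1] and
   [d2] (indices 0 and 1) if it is [Pair d1 d2].  Functions are unary. *)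
Inductive expr :=
  | EVar (i : nat)
  | ELeaf
  | EPair (e1 e2 : expr)
  | ECase (e e0 e1 : expr)
  | ELet (e1 e2 : expr)
  | ECall (f : nat) (e : expr).

Definition program := seq expr. (* function bodies; the main function is 0 *)

Definition body (P : program) (f : nat) : expr := nth ELeaf P f.

(* [eval P env e v t]: [e] evaluates to [v] in [t] steps. *)
Inductive eval (P : program) : seq data -> expr -> data -> nat -> Prop :=
  | eval_var env i :
      eval P env (EVar i) (nth Leaf env i) 1
  | eval_leaf env :
      eval P env ELeaf Leaf 1
  | eval_pair env e1 e2 v1 v2 t1 t2 :
      eval P env e1 v1 t1 -> eval P env e2 v2 t2 ->
      eval P env (EPair e1 e2) (Pair v1 v2) (t1 + t2).+1
  | eval_case_leaf env e e0 e1 v t t' :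
      eval P env e Leaf t -> eval P env e0 v t' ->
      eval P env (ECase e e0 e1) v (t + t').+1
  | eval_case_pair env e e0 e1 d1 d2 v t t' :
      eval P env e (Pair d1 d2) t -> eval P (d1 :: d2 :: env) e1 v t' ->
      eval P env (ECase e e0 e1) v (t + t').+1
  | eval_let env e1 e2 v1 v2 t1 t2 :
      eval P env e1 v1 t1 -> eval P (v1 :: env) e2 v2 t2 ->
      eval P env (ELet e1 e2) v2 (t1 + t2).+1
  | eval_call env f e u v t t' :
      eval P env e u t -> eval P [:: u] (body P f) v t' ->
      eval P env (ECall f e) v (t + t').+1.

(* Writing the result is charged with its size as a tree: subtrees may be shared
   in memory, so this can exceed the number of evaluation steps. *)
Definition outputs_in_time (P : program) (input output : data) (t : nat) : Prop :=
  exists2 s, eval P [:: input] (body P 0) output s & s + data_size output <= t.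

Definition enc_bool (b : bool) : data := if b then Pair Leaf Leaf else Leaf.

Definition enc_seq (A : Type) (enc : A -> data) (s : seq A) : data :=
  foldr (fun x d => Pair (enc x) d) Leaf s.

Definition enc_pair (A B : Type) (encA : A -> data) (encB : B -> data)
  (u : A * B) : data := Pair (encA u.1) (encB u.2).

Definition enc_var : var -> data := enc_seq enc_bool.

Definition enc_vars : seq var -> data := enc_seq enc_var.

Definition enc_quantifier (Q : quantifier) : data :=
  enc_bool (if Q is Forall then true else false).

Definition enc_qbf (phi : qbf) : data :=
  Pair (enc_seq (enc_pair enc_quantifier enc_vars) (qbf_prefix phi))
       (enc_seq (enc_seq (enc_pair enc_bool enc_var)) (qbf_matrix phi)).

Fixpoint enc_bagtree (t : bagtree) : data :=
  let: Node b ts := t in Pair (enc_vars b) (enc_seq enc_bagtree ts).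

Definition enc_instance (phi : qbf) (t : bagtree) : data :=
  Pair (enc_qbf phi) (enc_bagtree t).

(* Main.v *)
(* The innermost universal block is eliminated by dynamic programming over the
   tree decomposition.  For an assignment [a] of a bag, a new existential variable
   claims that every assignment of the universal variables compatible with [a]
   satisfies some term covered by a bag of the subtree.  As the variables of a term
   form a clique, by the Helly property of subtrees some bag contains all of them,
   so every term is covered.  A claim for [a] can be justified by a term that is
   true under [a], by an outer variable on which [a] differs from the actual
   assignment, or by one child whose claims hold for all assignments compatible
   with [a]: falsifying assignments for the children agree on the shared variables
   and can be glued.  A node has at most 2^(k+1) claims, children are treated one
   by one, and the claims on the two ends of an edge of the tree communicate
   through claims about the assignments of the shared variables, so that there are
   only O(2^k) clauses for each edge. *)
Require Import Defs.
From mathcomp Require Import all_boot.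
From mathcomp Require Import zify.

Set Implicit Arguments.
Unset Strict Implicit.
Unset Printing Implicit Defensive.

(** The clauses bound claims only from one side: a claim implies a justification, never conversely.
    This suffices because the unit clauses assert all claims about the root and justifications
    always descend in the tree, so they cannot be circular and the assignment that makes exactly the
    justified claims true is the greatest solution. A node with [m] children is unfolded into a
    chain of [m] joins above a single leaf, all with the same root bag. Terms are tested in leaves
    only, and each new bag deals with one edge of the original tree, so the degree of the tree does
    not enter the width. The lengths of names count in the running time. The new names must
    therefore be short, pairwise distinct and easy to compute: a name consists of a tag, a
    self-delimiting code of the path to the node, padding [F] that makes it longer than every outer
    name, and the truth values of the assignment. *)

(** * Trees and connectivity *)

(* A tree in first-child/next-sibling form: [BJoin l r] is [l] with [r] added as
   a child of its root, so that [Node b (t :: ts)] joins [Node b ts] and [t]. *)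
Inductive bintree := BLeaf (b : seq var) | BJoin (l r : bintree).

Fixpoint rbag (t : bintree) : seq var :=
  match t with BLeaf b => b | BJoin l _ => rbag l end.

Fixpoint bbags (t : bintree) : seq (seq var) :=
  match t with BLeaf b => [:: b] | BJoin l r => bbags l ++ bbags r end.

Fixpoint occ (x : var) (t : bintree) : bool :=
  match t with BLeaf b => x \in b | BJoin l r => occ x l || occ x r end.

(** The two parts of a join are linked only by the edge between their roots, so occurrences on both
    sides are connected only through it. *)
Fixpoint conn (x : var) (t : bintree) : bool :=
  match t with
  | BLeaf _ => true
  | BJoin l r =>
      [&& conn x l, conn x r &
          occ x l && occ x r ==> (x \in rbag l) && (x \in rbag r)]
  end.

Fixpoint bin_of (t : bagtree) : bintree :=
  let: Node b ts := t in
  foldr (fun t1 acc => BJoin acc (bin_of t1)) (BLeaf b) ts.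

(** Induction that peels off the first child, in step with [bin_of]; the nested list of children
    calls for a principle proved by hand. *)
Lemma bagtree_ind2 (P : bagtree -> Prop) :
  (forall b, P (Node b [::])) ->
  (forall b t ts, P t -> P (Node b ts) -> P (Node b (t :: ts))) ->
  forall t, P t.
Proof.
move=> H0 H1; fix IH 1 => -[b ts]; elim: ts => [|t ts IHts]; first exact: H0.
by apply: H1; [exact: IH | exact: IHts].
Qed.

Lemma rbag_bin_of b ts : rbag (bin_of (Node b ts)) = b.
Proof. by elim: ts => //= t ts. Qed.

Lemma bbags_bin_of t : bbags (bin_of t) =i bags t.
Proof.
elim/bagtree_ind2: t => [b|b t ts IHt IHts] y //=.
by move: (IHts y); rewrite mem_cat IHt /= !inE !mem_cat => ->; rewrite orbAC orbA.
Qed.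

Lemma rbag_in t : rbag t \in bbags t.
Proof. by elim: t => [b|l IHl r _] /=; rewrite ?mem_head // mem_cat IHl. Qed.

Lemma occP x t : reflect (exists2 b, b \in bbags t & x \in b) (occ x t).
Proof.
elim: t => [b|l IHl r IHr] /=.
  apply: (iffP idP) => [xb|[b']]; first by exists b; rewrite ?mem_head.
  by rewrite inE => /eqP->.
apply: (iffP orP) => [[/IHl|/IHr] [b bt xb]|[b]].
- by exists b; rewrite // mem_cat bt.
- by exists b; rewrite // mem_cat bt orbT.
by rewrite mem_cat => /orP[bt|bt] xb; [left; apply/IHl|right; apply/IHr]; exists b.
Qed.

Lemma rbag_occ x t : x \in rbag t -> occ x t.
Proof. by move=> xt; apply/occP; exists (rbag t); rewrite ?rbag_in. Qed.

(* Helly property of subtrees.  If every element of the clique occurs in [l], a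
   pair that shares a bag of [r] also shares the root bag of [l]; otherwise some
   element occurs only in [r], and so does a bag shared with any other. *)
Lemma clique_in_bag (C : seq var) t :
  {in C, forall x, conn x t} ->
  {in C &, forall x y, exists2 b, b \in bbags t & (x \in b) && (y \in b)} ->
  exists2 b, b \in bbags t & {subset C <= b}.
Proof.
elim: t => [b|l IHl r IHr] /= Cc Cp.
  exists b => [|x xC]; first exact: mem_head.
  by have [b'] := Cp x x xC xC; rewrite inE => /eqP-> /andP[].
have [allC|] := boolP (all (occ^~ l) C).
  have [||b bl Cb] := IHl; last by exists b; rewrite // mem_cat bl.
    by move=> x /Cc /and3P[].
  move=> x y xC yC; have [b] := Cp x y xC yC.
  rewrite mem_cat => /orP[bl|br] xyb; first by exists b.
  exists (rbag l); first exact: rbag_in.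
  case/andP: xyb => xb yb.
  have aux z : z \in C -> z \in b -> z \in rbag l.
    move=> zC zb; have /and3P[_ _ /implyP] := Cc z zC.
    rewrite (allP allC z zC) /=; case/(_ _)/andP => //.
    by apply/occP; exists b.
  by rewrite !aux.
case/allPn=> x0 x0C x0l.
have allC z : z \in C -> occ z r.
  move=> zC; have [b] := Cp x0 z x0C zC.
  rewrite mem_cat => /orP[bl|br] /andP[x0b zb].
    by case/negP: x0l; apply/occP; exists b.
  by apply/occP; exists b.
have [||b br Cb] := IHr; last by exists b; rewrite // mem_cat br orbT.
  by move=> x /Cc /and3P[].
move=> x y xC yC; have [b] := Cp x y xC yC.
rewrite mem_cat => /orP[bl|br] xyb; last by exists b.
exists (rbag r); first exact: rbag_in.
case/andP: xyb => xb yb.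
have aux z : z \in C -> z \in b -> z \in rbag r.
  move=> zC zb; have /and3P[_ _ /implyP] := Cc z zC.
  rewrite (allC z zC) andbT; case/(_ _)/andP => //.
  by apply/occP; exists b.
by rewrite !aux.
Qed.

(** * Node addresses and paths after adding a first child *)

Section Addresses.

Variables (x : var) (b : seq var) (t : bagtree) (ts : seq bagtree).
Let big := Node b (t :: ts).
Let rest := Node b ts.

(** [up] and [down] translate between addresses of [rest] and of [big], and [into] removes the step
    to [t]. Both [down] and [into] send the addresses of the opposite part to the root, so that a
    detour of a path collapses to one node. *)
Let up (p : seq nat) := if p is i :: p' then i.+1 :: p' else [::].
Let down (p : seq nat) := if p is i.+1 :: p' then i :: p' else [::].
Let into (p : seq nat) := if p is 0 :: p' then p' else [::].
Let inside (p : seq nat) := if p is 0 :: p' then true else false.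

Let upP p : node_has big x (up p) = node_has rest x p.
Proof. by case: p. Qed.

Let node_adj_up p q : node_adj (up p) (up q) = node_adj p q.
Proof. by case: p => [|i p]; case: q => [|j q]. Qed.

Let node_adj_cons p q : node_adj (0 :: p) (0 :: q) = node_adj p q.
Proof. by []. Qed.

Let node_has_cons p : node_has big x (0 :: p) = node_has t x p.
Proof. by []. Qed.

Let crossing p q : ~~ inside p -> inside q -> node_adj p q ->
  (p = [::]) * (q = [:: 0]).
Proof.
case: p => [|[|i] p] //; case: q => [|[|j] q] // _ _.
by rewrite /node_adj /child_of /= ?andbF ?orbF ?prefix0s /= eqSS; case: q.
Qed.

(** A path between nodes of [rest] may make detours into [t]. Under [down] these stay at the root,
    and repeated nodes are dropped. *)
Let path_down p s :
  node_has rest x (down p) -> path node_adj p s -> all (node_has big x) s ->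
  exists s', [/\ path node_adj (down p) s', last (down p) s' = down (last p s)
    & all (node_has rest x) s'].
Proof.
elim: s p => [|q s IHs] p /= xp; first by exists [::].
case/andP=> pq qs /andP[xq xs].
have [dpq|dpq] := eqVneq (down q) (down p).
  have [|s' [s1 s2 s3]] := IHs q _ qs xs; first by rewrite dpq.
  by exists s'; rewrite -dpq.
have [dxq adj] : node_has rest x (down q) /\ node_adj (down p) (down q).
  by case: p q xq pq dpq {IHs qs xp} => [|[|i] p] [|[|j] q].
have [s' [s1 s2 s3]] := IHs q dxq qs xs.
by exists (down q :: s'); rewrite /= adj s1 s2 dxq s3.
Qed.

Let path_into p s :
  node_has t x (into p) -> path node_adj p s -> all (node_has big x) s ->
  exists s', [/\ path node_adj (into p) s', last (into p) s' = into (last p s)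
    & all (node_has t x) s'].
Proof.
elim: s p => [|q s IHs] p /= xp; first by exists [::].
case/andP=> pq qs /andP[xq xs].
have [dpq|dpq] := eqVneq (into q) (into p).
  have [|s' [s1 s2 s3]] := IHs q _ qs xs; first by rewrite dpq.
  by exists s'; rewrite -dpq.
have [dxq adj] : node_has t x (into q) /\ node_adj (into p) (into q).
  case: p q xq pq dpq {IHs qs xp} => [|[|i] p] [|[|j] q] //=.
  - by case: q => //.
  - by case: p => //.
have [s' [s1 s2 s3]] := IHs q dxq qs xs.
by exists (into q :: s'); rewrite /= adj s1 s2 dxq s3.
Qed.

(** Such a path has to use the only edge between the two parts, and both ends of that edge contain
    [x]. *)
Let path_cross p s :
  ~~ inside p -> inside (last p s) -> path node_adj p s ->
  all (node_has big x) (p :: s) -> (x \in b) /\ node_has t x [::].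
Proof.
elim: s p => [|q s IHs] p /=; first by case: (inside p).
move=> pi li /andP[pq qs] /and3P[xp xq xs].
have [qi|qi] := boolP (inside q); last by apply: (IHs q) => //=; rewrite xq.
by have [ep eq] := crossing pi qi pq; move: xp xq; rewrite ep eq.
Qed.

Let outside p : ~~ inside p -> node_has big x p = node_has rest x (down p).
Proof. by case: p => [|[|i] p]. Qed.

(** This is the equation by which [conn] recurses at a join; it carries the definition by addresses
    and paths over to the binary tree. *)
Lemma occurrences_connected_cons :
  occurrences_connected big x <->
  [/\ occurrences_connected rest x, occurrences_connected t x
    & forall p q, node_has rest x p -> node_has t x q ->
        (x \in b) /\ node_has t x [::]].
Proof.
split=> [H|[Hr Ht Hc] p q].
  split=> [p q xp xq|p q xp xq|p q xp xq].
  - have [||s [s1 s2 s3]] := H (up p) (up q); rewrite ?upP //.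
    have dup r : down (up r) = r by case: r.
    have [|s' []] := path_down _ s1 s3; rewrite ?dup // s2 dup => *.
    by exists s'.
  - have [||s [s1 s2 s3]] := H (0 :: p) (0 :: q) => //.
    have [|s' []] := path_into _ s1 s3; rewrite // s2 => *.
    by exists s'.
  - have [||s [s1 s2 s3]] := H (up p) (0 :: q); rewrite ?upP //.
    by apply: (path_cross (p := up p) (s := s)); rewrite /= ?s2 ?s3 ?upP ?xp //; case: (p).
have liftup s r : path node_adj r s -> all (node_has rest x) s ->
    path node_adj (up r) (map up s) /\ all (node_has big x) (map up s).
  elim: s r => //= r' s IHs r /andP[rr' rs] /andP[xr' xs].
  by rewrite node_adj_up rr' upP xr' /=; exact: IHs.
have liftin s r : path node_adj r s -> all (node_has t x) s ->
    path node_adj (0 :: r) (map (cons 0) s) /\ all (node_has big x) (map (cons 0) s).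
  elim: s r => //= r' s IHs r /andP[rr' rs] /andP[xr' xs].
  by rewrite node_adj_cons rr' node_has_cons xr' /=; exact: IHs.
have updown r : ~~ inside r -> up (down r) = r by case: r => [|[|i] r].
have inin r : inside r -> 0 :: into r = r by case: r => [|[|i] r].
have lastup s r : last (up r) (map up s) = up (last r s) by rewrite last_map.
have lastin s r : last (0 :: r) (map (cons 0) s) = 0 :: last r s by rewrite last_map.
have inb r : inside r -> node_has big x r = node_has t x (into r).
  by case: r => [|[|i] r].
have [pi|pi] := boolP (inside p); have [qi|qi] := boolP (inside q).
- rewrite !inb // => xp xq; have [s [s1 s2 s3]] := Ht _ _ xp xq.
  have [s1' s3'] := liftin _ _ s1 s3; exists (map (cons 0) s).
  by rewrite -[p](inin p pi) lastin s2 (inin q qi).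
- rewrite inb // outside // => xp xq.
  have [xb xt] := Hc _ _ xq xp.
  have [s [s1 s2 s3]] := Ht _ _ xp xt.
  have [s1' s3'] := liftin _ _ s1 s3.
  have [r [r1 r2 r3]] := Hr [::] _ xb xq.
  have [r1' r3'] := liftup _ _ r1 r3.
  (* From [p] to the root of [t], across to the root of [big], and on to [q]. *)
  exists (map (cons 0) s ++ [::] :: map up r).
  rewrite cat_path last_cat all_cat -(inin p pi) lastin s2 /= s3' s1' /= r1' r3'.
  by rewrite -[[::]]/(up [::]) lastup r2 updown //= andbT; split=> //; rewrite /= xb.
- rewrite (inb q) // outside // => xp xq.
  have [xb xt] := Hc _ _ xp xq.
  have [s [s1 s2 s3]] := Hr _ [::] xp xb.
  have [s1' s3'] := liftup _ _ s1 s3.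
  have [r [r1 r2 r3]] := Ht [::] _ xt xq.
  have [r1' r3'] := liftin _ _ r1 r3.
  exists (map up s ++ [:: 0] :: map (cons 0) r).
  rewrite cat_path last_cat all_cat -(updown p pi) lastup s2 s3' s1' /=.
  by rewrite lastin r2 (inin q qi) r1' r3' !andbT.
- rewrite (outside pi) (outside qi) // => xp xq; have [s [s1 s2 s3]] := Hr _ _ xp xq.
  have [s1' s3'] := liftup _ _ s1 s3; exists (map up s).
  by rewrite -[p](updown p pi) lastup s2 (updown q qi).
Qed.

End Addresses.

Lemma node_has_root x t : node_has t x [::] = (x \in rbag (bin_of t)).
Proof. by case: t => b ts; rewrite rbag_bin_of. Qed.

Lemma occ_bin_of x t : occ x (bin_of t) <-> exists p, node_has t x p.
Proof.
elim/bagtree_ind2: t => [b|b t ts IHt IHts].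
  split=> [xb|[[|i p]]//]; first by exists [::].
  by rewrite /node_has /= onth0n.
split=> [/orP[/IHts[[|i p] xp]|/IHt[p xp]]|[[|[|i] p] xp]].
- by exists [::].
- by exists (i.+1 :: p).
- by exists (0 :: p).
- by apply/orP; left; apply/IHts; exists [::].
- by apply/orP; right; apply/IHt; exists p.
- by apply/orP; left; apply/IHts; exists (i :: p).
Qed.

Lemma conn_bin_of x t : conn x (bin_of t) <-> occurrences_connected t x.
Proof.
elim/bagtree_ind2: t => [b|b t ts IHt IHts].
  split=> // _ [|i p] [|j q] //; rewrite /node_has /= ?onth0n //.
  by exists [::].
have := rbag_bin_of b ts; rewrite /= => rb.
have o1 := occ_bin_of x (Node b ts); have o2 := occ_bin_of x t.
split=> [/= /and3P[c1 c2 /implyP H]|].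
  apply/occurrences_connected_cons; split; [exact/IHts|exact/IHt|].
  move=> p q xp xq; rewrite node_has_root; apply/andP; move: H; rewrite rb; apply.
  by apply/andP; split; [apply/o1; exists p|apply/o2; exists q].
move/occurrences_connected_cons=> [/IHts c1 /IHt c2 H] /=.
apply/and3P; split=> //; apply/implyP => /andP[/o1[p xp] /o2[q xq]].
by rewrite rb -node_has_root; apply/andP; apply: H xp xq.
Qed.

(** * The encoding *)

Fixpoint assigns (b : seq var) : seq (seq literal) :=
  if b is x :: b' then
    map (cons (true, x)) (assigns b') ++ map (cons (false, x)) (assigns b')
  else [:: [::]].

Definition restr (A : assignment) (b : seq var) : seq literal :=
  [seq (A x, x) | x <- b].

Definition tauts (b : seq var) : matrix :=
  [seq [:: (true, x); (false, x)] | x <- b].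

(** Selecting from this list by an assignment gives the restriction to [b] with its literals in the
    order of [b], so equal restrictions are equal lists. *)
Definition lits (b : seq var) : seq literal := flatten (tauts b).

Definition sel (L a : seq literal) : seq literal := [seq l <- L | l \in a].

(* [sel c a == c] iff all literals of [c] are in [a], which is the case iff [c] is
   true under [a] and all its variables are in the domain of [a]. *)
Definition holds (psi : matrix) (a : seq literal) : bool :=
  has (fun c => sel c a == c) psi.

Lemma size_assigns b : size (assigns b) = 2 ^ size b.
Proof. by elim: b => //= x b IHb; rewrite size_cat !size_map IHb expnS mul2n addnn. Qed.

Lemma mem_assigns b a : (a \in assigns b) = (map snd a == b).
Proof.
elim: b a => [|x b IHb] [|[c y] a] //=; rewrite mem_cat.
- by apply/negbTE; apply/negP => /orP[] /mapP[].
- apply/idP/idP => [/orP[] /mapP[a' Ha' [_ -> ->]]|]; rewrite ?eqseq_cons ?eqxx -?IHb //.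
  case/andP=> /eqP-> Ha.
  by case: c; rewrite !mem_map ?Ha ?orbT // => ? ? [].
Qed.

Lemma restr_assigns A b : restr A b \in assigns b.
Proof. by rewrite mem_assigns -map_comp map_id. Qed.

(** With a repeated variable, a list in [assigns b] could contain both of its literals and would
    come from no assignment. *)
Lemma assignsP b a : uniq b -> a \in assigns b -> exists A, a = restr A b.
Proof.
rewrite mem_assigns => + /eqP eb; rewrite -{}eb => ub.
exists (fun x => (true, x) \in a).
elim: a ub => //= -[c x] a IHa /= /andP[xa ua].
have xN c' : (c', x) \in a = false.
  by apply/negbTE/negP => /(map_f snd); rewrite (negbTE xa).
rewrite in_cons xN orbF (_ : ((true, x) == (c, x)) = c); last first.
  by rewrite xpair_eqE eqxx andbT; case: (c).
congr cons; rewrite {1}IHa // /restr -!map_comp; apply/eq_in_map => l la /=.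
rewrite in_cons xpair_eqE; case: (eqVneq l.2 x) => [e|]; last by rewrite andbF.
by move: xa; rewrite -e map_f.
Qed.

Lemma mem_restr A b c x : ((c, x) \in restr A b) = (x \in b) && (A x == c).
Proof.
apply/mapP/andP => [[y yb [-> ->]]|[xb /eqP<-]]; first by rewrite eqxx.
by exists x.
Qed.

Lemma mem_lits c x b : ((c, x) \in lits b) = (x \in b).
Proof.
elim: b => //= y b; rewrite !inE => ->.
by rewrite !xpair_eqE; case: c; case: eqP.
Qed.

Lemma sel_restr A d b : {subset d <= b} -> sel (lits d) (restr A b) = restr A d.
Proof.
elim: d => //= x d IHd sdb; rewrite !mem_restr sdb ?mem_head //=.
rewrite -/(sel _ _) IHd; last by move=> y yd; rewrite sdb // in_cons yd orbT.
by case: (A x).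
Qed.

Lemma restr_eq_in A B b : {in b, A =1 B} -> restr A b = restr B b.
Proof. by move=> AB; apply/eq_in_map => x xb; rewrite AB. Qed.

Lemma restr_inj A B b : restr A b = restr B b -> {in b, A =1 B}.
Proof. by move=> /eq_in_map AB x /AB[]. Qed.

Lemma holdsP psi A b :
  holds psi (restr A b) =
  has (fun c => all (lit_true A) c && all (mem b) (map snd c)) psi.
Proof.
apply: eq_has => c; rewrite /sel; apply/eqP/andP.
  move/all_filterP/allP => cA; split; apply/allP.
    by case=> s x /cA; rewrite mem_restr => /andP[].
  by move=> x /mapP[[s y] /cA]; rewrite mem_restr => /andP[yb _] ->.
case=> /allP cA /allP cb; apply/all_filterP/allP => -[s x] lc.
rewrite mem_restr; apply/andP; split; last exact: cA lc.
exact/cb/(map_f snd lc).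
Qed.

Section Elimination.

(* [O] lists the outer variables, and [F] is at least as long as each of them. *)
Variables (O : seq var) (psi : matrix) (F : seq bool).

(* A path to a node of the binary tree, from the node upwards. *)
Definition path_code (p : seq bool) : seq bool :=
  foldr (fun c w => true :: c :: w) (false :: F) p.

Definition name_prefix (k : bool) (p : seq bool) := [:: false, k & path_code p].

Definition names (u : var) (s : seq (seq literal)) : seq var :=
  [seq u ++ map fst a | a <- s].

(* For an assignment [a] of the root bag of the subtree at [p], the variable
   [nm false p a] claims that [a] contradicts the outer variables or that every
   assignment extending [a] and the outer variables satisfies a term covered by a
   bag of this subtree.  For an assignment [g] of the variables shared by the two
   parts of a join at [p], [nm true p g] claims the same of the right part and all
   assignments of its root bag extending [g]. *)
Definition nm k p (a : seq literal) : var := name_prefix k p ++ map fst a.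

Definition shared (l r : bintree) : seq var := [seq x <- rbag r | x \in rbag l].

Definition outer_of (b : seq var) : seq var := [seq x <- b | x \in O].

Definition blockers (b : seq var) (a : seq literal) : seq literal :=
  [seq l <- lits (outer_of b) | l \notin a].

Definition rvars p b := names (name_prefix false p) (assigns b).
Definition svars p l r := names (name_prefix true p) (assigns (shared l r)).

Definition xbag (t : bintree) (p : seq bool) : seq var :=
  match t with
  | BLeaf b => rvars p b ++ outer_of b
  | BJoin l r =>
      rvars p (rbag l) ++ rvars (false :: p) (rbag l) ++
      rvars (true :: p) (rbag r) ++ svars p l r ++ outer_of (rbag l)
  end.

(* A leaf clause has a positive head when a term holds: it is then harmless, as the
   claim is true.  Its other literals are false iff [a] agrees with the outer
   variables. *)
Definition own_cls (t : bintree) (p : seq bool) : matrix :=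
  match t with
  | BLeaf b => [seq (holds psi a, nm false p a) :: blockers b a | a <- assigns b]
  | BJoin l r =>
      (* The first family offers two justifications, the left part or the claim shared with the
         right part; the second lets a shared claim imply the claims of all assignments of the right
         root bag that extend it. *)
      [seq [:: (false, nm false p a); (true, nm false (false :: p) a);
               (true, nm true p (sel (lits (shared l r)) a))]
      | a <- assigns (rbag l)] ++
      [seq [:: (false, nm true p (sel (lits (shared l r)) a));
               (true, nm false (true :: p) a)]
      | a <- assigns (rbag r)]
  end.

Fixpoint tree (t : bintree) (p : seq bool) : bagtree :=
  Node (xbag t p)
    (if t is BJoin l r then [:: tree l (false :: p); tree r (true :: p)]
     else [::]).

(* The tautologies make every variable of a bag occur in the matrix. *)
Fixpoint cls (t : bintree) (p : seq bool) : matrix :=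
  own_cls t p ++ tauts (xbag t p) ++
  (if t is BJoin l r then cls l (false :: p) ++ cls r (true :: p) else [::]).

Fixpoint aux (t : bintree) (p : seq bool) : seq var :=
  match t with
  | BLeaf b => rvars p b
  | BJoin l r =>
      rvars p (rbag l) ++ svars p l r ++
      aux l (false :: p) ++ aux r (true :: p)
  end.

(** * Semantics *)

Section Semantics.

Variable a : assignment.

Definition forced_join (f : seq literal -> bool) (l r : bintree) (g : seq literal) :=
  all (fun be => (sel (lits (shared l r)) be == g) ==> f be) (assigns (rbag r)).

(* The greatest solution of the clauses: the claims that can be justified. *)
Fixpoint forced (t : bintree) (al : seq literal) : bool :=
  match t with
  | BLeaf b => holds psi al || has (lit_true a) (blockers b al)
  | BJoin l r => forced l al || forced_join (forced r) l r (sel (lits (shared l r)) al)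
  end.

(** The solution [forced] as a table of values for the new variables; as the names are distinct, the
    table defines an assignment. *)
Fixpoint env (t : bintree) (p : seq bool) : seq (bool * var) :=
  [seq (forced t al, nm false p al) | al <- assigns (rbag t)] ++
  (if t is BJoin l r then
     [seq (forced_join (forced r) l r g, nm true p g) | g <- assigns (shared l r)] ++
     env l (false :: p) ++ env r (true :: p)
   else [::]).

Lemma env_vars t p : map snd (env t p) = aux t p.
Proof.
elim: t p => [b|l IHl r IHr] p /=; first by rewrite cats0 -map_comp.
by rewrite !map_cat IHl IHr -!map_comp.
Qed.

Lemma shared_l l r : {subset shared l r <= rbag l}.
Proof. by move=> x; rewrite mem_filter => /andP[]. Qed.

Lemma shared_r l r : {subset shared l r <= rbag r}.
Proof. by move=> x; rewrite mem_filter => /andP[]. Qed.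

Lemma uniq_rbag t : all uniq (bbags t) -> uniq (rbag t).
Proof. by move/allP; apply; rewrite rbag_in. Qed.

Lemma has_blockers v b al :
  {in O, v =1 a} ->
  has (lit_true v) (blockers b al) = has (lit_true a) (blockers b al).
Proof.
move=> va; apply: eq_in_has => -[c x].
by rewrite mem_filter mem_lits mem_filter => /andP[_ /andP[xO _]]; rewrite /lit_true va.
Qed.

(** Every clause is one direction of an equation defining [forced], and every tautology holds
    anyway. *)
Lemma env_satisfies v t p :
  all uniq (bbags t) ->
  {in O, v =1 a} -> {in env t p, forall l, v l.2 = l.1} -> cnf_true v (cls t p).
Proof.
move=> + va; elim: t p => [b|l IHl r IHr] p /= ut ve.
  rewrite cats0 /cnf_true all_cat; apply/andP; split; apply/allP => c /mapP[].
    move=> al Aal -> /=; rewrite has_blockers // {1}/lit_true.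
    rewrite (ve (forced (BLeaf b) al, nm false p al)) /=.
      by case: (holds _ _); case: (has _ _).
    by rewrite cats0; apply/mapP; exists al.
  by move=> x _ -> /=; rewrite /lit_true /=; case: (v x).
move: ut; rewrite all_cat => /andP[ul ur].
rewrite /cnf_true !all_cat; apply/and4P; split.
- apply/andP; split; apply/allP => c /mapP[al Aal ->] /=; rewrite /lit_true /=.
    have [A eal] := assignsP (uniq_rbag ul) Aal.
    rewrite (ve (forced (BJoin l r) al, nm false p al)) /=; last first.
      by rewrite mem_cat; apply/orP; left; apply/mapP; exists al.
    rewrite (ve (forced l al, nm false (false :: p) al)) /=; last first.
      rewrite !mem_cat; do 2 (apply/orP; right); apply/orP; left.
      (* [env l _] exposes its first list only after case analysis on [l]. *)
      case: (l) Aal => [?|? ?] Aal; rewrite mem_cat; apply/orP; left; apply/mapP; by exists al.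
    rewrite (ve (forced_join (forced r) l r (sel (lits (shared l r)) al),
                 nm true p (sel (lits (shared l r)) al))) /=.
      by case: (forced l al) => //=; case: (forced_join _ _ _ _).
    rewrite !mem_cat; apply/orP; right; apply/orP; left; apply/mapP.
    exists (sel (lits (shared l r)) al) => //.
    by rewrite eal sel_restr ?restr_assigns //; exact: shared_l.
  have [A eal] := assignsP (uniq_rbag ur) Aal.
  rewrite (ve (forced r al, nm false (true :: p) al)) /=; last first.
    rewrite !mem_cat; do 3 (apply/orP; right).
    case: (r) Aal => [?|? ?] Aal; rewrite mem_cat; apply/orP; left; apply/mapP; by exists al.
  rewrite (ve (forced_join (forced r) l r (sel (lits (shared l r)) al),
               nm true p (sel (lits (shared l r)) al))) /=.
    have [/allP/(_ _ Aal)|] := boolP (forced_join _ _ _ _); last by [].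
    by rewrite eqxx /= => ->.
  rewrite !mem_cat; apply/orP; right; apply/orP; left; apply/mapP.
  exists (sel (lits (shared l r)) al) => //.
  by rewrite eal sel_restr ?restr_assigns //; exact: shared_r.
- apply/allP => c /mapP[x _ ->] /=.
  by rewrite /lit_true /=; case: (v x).
- by apply: IHl => // x xl; apply: ve; rewrite !mem_cat xl !orbT.
- by apply: IHr => // x xl; apply: ve; rewrite !mem_cat xl !orbT.
Qed.

(** Induction on the tree works because a claim about the root bag of a subtree is justified only by
    claims about the parts of that subtree; hence [forced] is an upper bound for every solution. *)
Lemma satisfies_forced v t p al :
  {in O, v =1 a} -> cnf_true v (cls t p) -> al \in assigns (rbag t) ->
  v (nm false p al) -> forced t al.
Proof.
move=> va; elim: t p al => [b|l IHl r IHr] p al /=.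
  rewrite /cnf_true all_cat => /andP[/allP H _] Aal vr.
  have /= := H _ (map_f _ Aal); rewrite has_blockers // {1}/lit_true /= vr.
  by case: (holds _ _).
rewrite /cnf_true !all_cat => /and4P[/andP[/allP H1 /allP H2] _ Hl Hr] Aal vr.
have /= := H1 _ (map_f _ Aal); rewrite {1}/lit_true vr /= orbF.
case/orP => [v0|vs]; first by rewrite (IHl _ _ Hl Aal) //; apply/eqP.
apply/orP; right; apply/allP => be Abe; apply/implyP => /eqP e.
have /= := H2 _ (map_f _ Abe); rewrite e orbF {1}/lit_true /= (eqP vs) /=.
by move/eqP=> v1; apply: (IHr _ _ Hr Abe).
Qed.

(** Following the justification of the claims that agree with [A] leads to a leaf. There no blocker
    can be true, as [A] and [a] agree on [O], so a term is. *)
Lemma forced_true t A :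
  {in O, A =1 a} -> forced t (restr A (rbag t)) -> dnf_true A psi.
Proof.
move=> Aa; elim: t => [b|l IHl r IHr] /=.
  case/orP=> [|/hasP[[c x]]].
    by rewrite holdsP => /hasP[c cp /andP[Ac _]]; apply/hasP; exists c.
  rewrite mem_filter mem_lits mem_filter mem_restr => /andP[nx /andP[xO xb]].
  by move: nx; rewrite xb /lit_true Aa //= => /negbTE->.
case/orP=> [|/allP/(_ _ (restr_assigns A (rbag r)))]; first exact: IHl.
rewrite !sel_restr ?eqxx; [exact: IHr|exact: shared_l|exact: shared_r].
Qed.

(* Falsifying assignments of the two parts of a join agree on the variables that
   occur in both. *)
Lemma not_forced t al :
  all uniq (bbags t) -> (forall x, conn x t) ->
  al \in assigns (rbag t) -> ~~ forced t al ->
  exists A, [/\ al = restr A (rbag t), {in O, A =1 a}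
    & forall c b, c \in psi -> b \in bbags t -> {subset map snd c <= b} ->
        ~~ all (lit_true A) c].
Proof.
elim: t al => [b|l IHl r IHr] al /=.
  rewrite andbT => ub _ Aal; have [A0 e] := assignsP ub Aal.
  rewrite negb_or => /andP[nh nb].
  (* Outside the bag the values of [a] are taken; inside it, a disagreement with [a] on an outer
     variable would be a true blocker. *)
  pose A x := if x \in b then A0 x else a x.
  have eA : al = restr A b.
    by rewrite e; apply: restr_eq_in => x xb; rewrite /A xb.
  exists A; split=> // [x xO|c b' cp].
    rewrite /A; case: ifP => // xb; apply/eqP; apply: contraNT nb => ne.
    apply/hasP; exists (a x, x); last by rewrite /lit_true eqxx.
    by rewrite mem_filter mem_lits mem_filter xO xb e mem_restr xb ne.
  rewrite inE => /eqP-> cb; apply: contra nh => Ac.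
  by rewrite eA holdsP; apply/hasP; exists c; rewrite // Ac; apply/allP.
rewrite all_cat => /andP[ul ur] ct Aal; rewrite negb_or => /andP[nl].
case/allPn=> be Abe; rewrite negb_imply => /andP[/eqP e nr].
have [x|Al [eal AlO Alc]] := IHl al ul _ Aal nl; first by have /and3P[] := ct x.
have [x|Ar [ebe ArO Arc]] := IHr be ur _ Abe nr; first by have /and3P[] := ct x.
pose A x := if occ x l then Al x else Ar x.
have AAl x : occ x l -> A x = Al x by rewrite /A => ->.
have AAr x : occ x r -> A x = Ar x.
  move=> xr; rewrite /A; case: ifP => // xl.
  have /and3P[_ _] := ct x; rewrite xl xr /= => /andP[xbl xbr].
  move: e; rewrite eal ebe !sel_restr; [|exact: shared_l|exact: shared_r].
  by move/restr_inj => -> //; rewrite mem_filter xbl.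
exists A; split.
- by rewrite eal; apply: restr_eq_in => x xl; rewrite AAl // rbag_occ.
- by move=> x xO; rewrite /A; case: ifP => _; rewrite ?AlO ?ArO.
move=> c b cp; rewrite mem_cat => /orP[bl|br] cb.
  rewrite (@eq_in_all _ _ (lit_true Al)) ?(Alc c b) // => -[s x] lc.
  rewrite /lit_true /= AAl //; apply/occP; exists b => //; apply: cb.
  by apply/mapP; exists (s, x).
rewrite (@eq_in_all _ _ (lit_true Ar)) ?(Arc c b) // => -[s x] lc.
rewrite /lit_true /= AAr //; apply/occP; exists b => //; apply: cb.
by apply/mapP; exists (s, x).
Qed.

End Semantics.

(** * Names *)

(** Each step is announced by [true] and the end by [false], after which [F] has a fixed length; so
    the code can be read off the front of a name. *)
Lemma path_code_inj p q z z' :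
  path_code p ++ z = path_code q ++ z' -> p = q /\ z = z'.
Proof.
elim: p q => [|c p IHp] [|d q] //=.
  by move=> [] /eqP; rewrite eqseq_cat // eqxx => /eqP.
by case=> -> /IHp[-> ->].
Qed.

Lemma nm_inj k k' p q al be :
  nm k p al = nm k' q be -> [/\ k = k', p = q & map fst al = map fst be].
Proof. by case=> -> /path_code_inj[]. Qed.

Lemma uniq_names u b : uniq (names u (assigns b)).
Proof.
rewrite /names (map_comp (cat u)) map_inj_uniq; last first.
  by move=> z z' /eqP; rewrite eqseq_cat // eqxx => /eqP.
elim: b => //= x b IHb.
have e c : [seq map fst a | a <- map (cons (c, x)) (assigns b)] =
    map (cons c) [seq map fst a | a <- assigns b] by rewrite -!map_comp.
have consI (c : bool) : injective (cons c) by move=> ? ? [].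
rewrite map_cat !e cat_uniq !(map_inj_uniq (consI _)) IHb andbT /=.
by apply/hasPn => z /mapP[z' _ ->]; apply/negP => /mapP[].
Qed.

(** Paths are listed from the node upwards, so those below [p] end in [p]. This separates the names
    of a subtree from those of its sibling and of its ancestors. *)
Lemma auxP t p x : x \in aux t p -> exists k q al, x = nm k (q ++ p) al.
Proof.
elim: t p => [b|l IHl r IHr] p /=.
  by case/mapP=> al _ ->; exists false, [::], al.
rewrite !mem_cat => /or4P[/mapP[al _ ->]|/mapP[al _ ->]|/IHl|/IHr].
- by exists false, [::], al.
- by exists true, [::], al.
- by move=> [k [q [al ->]]]; exists k, (rcons q false), al; rewrite cat_rcons.
- by move=> [k [q [al ->]]]; exists k, (rcons q true), al; rewrite cat_rcons.
Qed.

Lemma aux_lr l r p x : x \in aux l (false :: p) -> x \in aux r (true :: p) -> False.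
Proof.
move=> /auxP[k [q [al ->]]] /auxP[k' [q' [al' /nm_inj[_ + _]]]].
rewrite -!cat_rcons => /eqP e.
(* The two paths have the same length, so the steps taken at the join are at the same position,
   where they differ. *)
have es : size q = size q'.
  by move/eqP: e => /(congr1 size); rewrite !size_cat !size_rcons => /addIn [].
by move: e; rewrite eqseq_cat ?size_rcons ?es // eqseq_rcons andbF.
Qed.

Lemma aux_up k p al t c : nm k p al \in aux t (c :: p) -> False.
Proof.
case/auxP=> k' [q [al' /nm_inj[_ /(congr1 size) + _]]].
rewrite size_cat /=; lia.
Qed.

Lemma uniq_aux t p : uniq (aux t p).
Proof.
elim: t p => [b|l IHl r IHr] p /=; first exact: uniq_names.
rewrite !cat_uniq IHl IHr !uniq_names /= andbT !has_cat !negb_or.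
have H k u c t : ~~ has (mem (names (name_prefix k p) u)) (aux t (c :: p)).
  apply/hasPn => x xt; apply/negP => /mapP[al _ e].
  by apply: (@aux_up k p al t c); move: xt; rewrite e.
rewrite !H /= !andbT; apply/andP; split.
  by apply/hasPn => x /mapP[al _ ->]; apply/negP => /mapP[be _ /nm_inj[]].
by apply/hasPn => x xr; apply/negP => /aux_lr; apply; exact: xr.
Qed.

Lemma rvars_aux t p : {subset rvars p (rbag t) <= aux t p}.
Proof. by case: t => [b|l r] x //= xr; rewrite mem_cat xr. Qed.

Hypothesis OF : {in O, forall x, size x <= size F}.

Lemma size_path_code p : size (path_code p) = (2 * size p + size F).+1.
Proof. by elim: p => //= c p ->; lia. Qed.

(** The name contains [F] and further bits, so it is longer than any outer variable. Only outer
    variables have to be avoided, as the universal block disappears. *)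
Lemma nm_fresh k p al : nm k p al \notin O.
Proof.
apply/negP => /OF; rewrite /nm /name_prefix /= size_cat size_path_code; lia.
Qed.

Lemma aux_fresh t p x : x \in aux t p -> x \notin O.
Proof. by case/auxP=> k [q [al ->]]; exact: nm_fresh. Qed.

(** * Tree decomposition *)

Definition xocc x t p := x \in flatten (bags (tree t p)).

Lemma xbag_sub t p x : x \in xbag t p -> (x \in aux t p) || (x \in O) && (x \in rbag t).
Proof.
case: t => [b|l r] /=; first by rewrite mem_cat mem_filter => /orP[->|->]; rewrite ?orbT.
rewrite !mem_cat mem_filter.
case/or4P=> [->|/(rvars_aux (t := l))->|/(rvars_aux (t := r))->|/orP[->|->]];
  by rewrite ?orbT.
Qed.

Lemma bags_tree_join l r p :
  bags (tree (BJoin l r) p) =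
  xbag (BJoin l r) p :: bags (tree l (false :: p)) ++ bags (tree r (true :: p)).
Proof. by rewrite /= cats0. Qed.

Lemma xocc_join l r p x :
  xocc x (BJoin l r) p =
  [|| x \in xbag (BJoin l r) p, xocc x l (false :: p) | xocc x r (true :: p)].
Proof. by rewrite /xocc -!mem_cat /= cats0 flatten_cat. Qed.

Lemma xocc_sub t p x : xocc x t p -> (x \in aux t p) || (x \in O) && occ x t.
Proof.
elim: t p => [b|l IHl r IHr] p.
  by rewrite /xocc /= cats0; exact: (@xbag_sub (BLeaf b)).
rewrite xocc_join; case/or3P=> [xB|/IHl|/IHr].
- have /orP[->//|/andP[-> /rbag_occ->]] := xbag_sub xB.
  by rewrite orbT.
- by rewrite /= !mem_cat; case/orP=> [->|/andP[-> ->]]; rewrite ?orbT.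
- by rewrite /= !mem_cat; case/orP=> [->|/andP[-> ->]]; rewrite ?orbT.
Qed.

Lemma rbag_tree t p : rbag (bin_of (tree t p)) = xbag t p.
Proof. by case: t => *; rewrite [tree _ _]/= rbag_bin_of. Qed.

Lemma occ_tree t p x : occ x (bin_of (tree t p)) = xocc x t p.
Proof.
apply/occP/flattenP => -[b bt xb]; exists b => //.
  by rewrite -bbags_bin_of.
by rewrite bbags_bin_of.
Qed.

Lemma rvars_xbag t p : {subset rvars p (rbag t) <= xbag t p}.
Proof. by case: t => [b|l r] x xr; rewrite mem_cat xr. Qed.

Lemma outer_xbag t p x : x \in O -> (x \in xbag t p) = (x \in rbag t).
Proof.
move=> xO.
have no k q u : x \in names (name_prefix k q) u = false.
  by apply/negbTE/negP => /mapP[al _ e]; move: (nm_fresh k q al); rewrite /nm -e xO.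
by case: t => [b|l r] /=; rewrite !mem_cat !no /= mem_filter xO.
Qed.

(** An outer variable is in a new bag iff it is in the old root bag at that node, so it inherits its
    connectivity. A new variable occurs in the bag of its own node and at most in that of the join
    above it. *)
Lemma conn_tree t p x : conn x t -> conn x (bin_of (tree t p)).
Proof.
elim: t p => [b|l IHl r IHr] p //= /and3P[cl cr /implyP lr].
rewrite IHl ?IHr //= -!/(xbag (BJoin _ _) _) !rbag_tree !occ_tree.
set B := xbag (BJoin l r) p.
(* Both parts become children of a node with bag [B]; [H3] excludes a variable that passes between
   the children around [B]. *)
suff [H1 H2 H3] : [/\ x \in B -> xocc x l (false :: p) -> x \in xbag l (false :: p),
    x \in B -> xocc x r (true :: p) -> x \in xbag r (true :: p)
    & xocc x l (false :: p) -> xocc x r (true :: p) -> x \in B].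
  apply/andP; split; apply/implyP=> /andP[].
    by move=> xB xr; rewrite xB H2.
  case/orP=> [xB|xr] xl; first by rewrite xB H1.
  by have xB := H3 xl xr; rewrite xB H1.
have [xO|xO] := boolP (x \in O).
  have sub t' p' : xocc x t' p' -> occ x t'.
    by case/xocc_sub/orP=> [/aux_fresh|/andP[]//]; rewrite xO.
  rewrite /B !outer_xbag //; split=> //.
    by move=> /(@rbag_occ x l) xl /sub xr; have /andP[] := lr (introT andP (conj xl xr)).
  by move=> /sub xl /sub xr; have /andP[] := lr (introT andP (conj xl xr)).
have sub t' p' : xocc x t' p' -> x \in aux t' p'.
  by case/xocc_sub/orP=> // /andP[xO']; rewrite xO' in xO.
have BP : x \in B -> [\/ exists k al, x = nm k p al, x \in rvars (false :: p) (rbag l)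
    | x \in rvars (true :: p) (rbag r)].
  rewrite /B /= !mem_cat mem_filter (negbTE xO) orbF.
  case/or4P=> [/mapP[al _ e]|xr|xr|/mapP[al _ e]].
  - by apply: Or31; exists false, al.
  - exact: Or32.
  - exact: Or33.
  - by apply: Or31; exists true, al.
split.
- move=> /BP[[k [al e]] /sub|xr _|/rvars_aux xr /sub xl].
  + by rewrite e => /aux_up.
  + exact: rvars_xbag.
  + by case: (aux_lr xl xr).
- move=> /BP[[k [al e]] /sub|/rvars_aux xl /sub xr|xr _].
  + by rewrite e => /aux_up.
  + by case: (aux_lr xl xr).
  + exact: rvars_xbag.
- by move=> /sub xl /sub xr; case: (aux_lr xl xr).
Qed.

Lemma uniq_xbag t p : uniq (rbag t) -> uniq (xbag t p).
Proof.
have H k q u b : ~~ has (mem (names (name_prefix k q) u)) (outer_of b).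
  apply/hasPn => x; rewrite mem_filter => /andP[xO _]; apply/negP => /mapP[al _ e].
  by move: (nm_fresh k q al); rewrite /nm -e xO.
have D k q u k' q' u' : (k, q) != (k', q') ->
    ~~ has (mem (names (name_prefix k q) u)) (names (name_prefix k' q') u').
  move=> ne; apply/hasPn => x /mapP[al _ ->]; apply/negP => /mapP[be _ /nm_inj[e1 e2 _]].
  by rewrite e1 e2 eqxx in ne.
case: t => [b|l r] /= ub; first by rewrite cat_uniq uniq_names H filter_uniq.
have np c : (c :: p == p) = false by apply/negbTE/negP => /eqP/(congr1 size) /=; lia.
rewrite !cat_uniq !has_cat !uniq_names !negb_or !H filter_uniq //=.
by rewrite !D // xpair_eqE ?(eq_sym p) ?np // andbF.
Qed.

Lemma uniq_bags_tree t p : all uniq (bbags t) -> all uniq (bags (tree t p)).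
Proof.
elim: t p => [b|l IHl r IHr] p ut.
  by rewrite [bags _]/= all_seq1; exact: uniq_xbag (uniq_rbag ut).
rewrite bags_tree_join -cat1s !all_cat all_seq1 uniq_xbag; last exact: uniq_rbag ut.
by move: ut; rewrite /= all_cat => /andP[/IHl-> /IHr->].
Qed.

Lemma own_cls_sub t p c : all uniq (bbags t) ->
  c \in own_cls t p -> {subset map snd c <= xbag t p}.
Proof.
have nmr q b al : al \in assigns b -> nm false q al \in rvars q b.
  by move=> Aal; apply/mapP; exists al.
case: t => [b|l r] /= ut.
  case/mapP=> al Aal -> x /=; rewrite inE mem_cat => /orP[/eqP->|].
    by rewrite nmr.
  case/mapP=> -[s y]; rewrite mem_filter mem_lits => /andP[_ yb] /= ->.
  by rewrite yb orbT.
move: ut; rewrite all_cat => /andP[ul ur].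
rewrite mem_cat => /orP[] /mapP[al Aal ->] x /=; rewrite !inE !mem_cat.
  case/or3P=> /eqP->; rewrite ?nmr ?orbT //; apply/orP; right.
  do 2 (apply/orP; right); apply/orP; left.
  apply/mapP; exists (sel (lits (shared l r)) al) => //.
  have [A ->] := assignsP (uniq_rbag ul) Aal.
  by rewrite sel_restr ?restr_assigns //; exact: shared_l.
case/orP=> /eqP->; rewrite ?nmr ?orbT //.
do 3 (apply/orP; right); apply/orP; left.
apply/mapP; exists (sel (lits (shared l r)) al) => //.
have [A ->] := assignsP (uniq_rbag ur) Aal.
by rewrite sel_restr ?restr_assigns //; exact: shared_r.
Qed.

Lemma cls_sub t p c : all uniq (bbags t) -> c \in cls t p ->
  exists2 b, b \in bags (tree t p) & {subset map snd c <= b}.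
Proof.
elim: t p => [b|l IHl r IHr] p ut.
  rewrite /= cats0 mem_cat => /orP[ct|/mapP[x xt ->]];
    exists (xbag (BLeaf b) p); rewrite ?mem_head //.
    exact: own_cls_sub ut ct.
  by move=> y; rewrite !inE orbb => /eqP->.
rewrite [cls _ _]/= [bags _]/= cats0.
rewrite mem_cat => /orP[ct|].
  exists (xbag (BJoin l r) p); first exact: mem_head.
  exact: own_cls_sub ut ct.
move: ut; rewrite /= all_cat => /andP[ul ur].
rewrite !mem_cat => /or3P[/mapP[x xt ->]|/IHl[//|b bt cb]|/IHr[//|b bt cb]].
- exists (xbag (BJoin l r) p); first exact: mem_head.
  by move=> y; rewrite !inE orbb => /eqP->.
- by exists b; rewrite // inE mem_cat bt !orbT.
- by exists b; rewrite // inE mem_cat bt !orbT.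
Qed.

Lemma bags_cls t p b x : b \in bags (tree t p) -> x \in b ->
  [:: (true, x); (false, x)] \in cls t p.
Proof.
elim: t p => [b'|l IHl r IHr] p /=.
  by rewrite inE => /eqP-> xb; rewrite cats0 mem_cat map_f ?orbT.
rewrite cats0 inE mem_cat => /or3P[/eqP->|bl|br] xb; rewrite !mem_cat.
- by rewrite (map_f _ xb) !orbT.
- by rewrite (IHl _ bl) ?orbT.
- by rewrite (IHr _ br) ?orbT.
Qed.

(** Deliberately crude: the outer variables then count like one more group of claims. *)
Lemma size_outer_of b : size (outer_of b) <= 2 ^ size b.
Proof. by rewrite size_filter (leq_trans (count_size _ _)) // ltnW // ltn_expl. Qed.

Lemma size_shared l r : size (shared l r) <= size (rbag r).
Proof. by rewrite size_filter count_size. Qed.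

Lemma size_names u b : size (names u (assigns b)) = 2 ^ size b.
Proof. by rewrite size_map size_assigns. Qed.

(** * Sizes of the new bags *)

Section Sizes.

Variable K : nat.

(** Bags are measured by their number of assignments because the later counts are linear in it. *)
Definition small_bags (t : bintree) := {in bbags t, forall b, 2 ^ size b <= K}.

Lemma small_bags_join l r : small_bags (BJoin l r) <-> small_bags l /\ small_bags r.
Proof.
split=> [H|[Hl Hr] b]; last by rewrite mem_cat => /orP[/Hl|/Hr].
by split=> b bt; apply: H; rewrite mem_cat bt ?orbT.
Qed.

Lemma small_rbag t : small_bags t -> 2 ^ size (rbag t) <= K.
Proof. by apply; exact: rbag_in. Qed.

Lemma small_shared l r : small_bags r -> 2 ^ size (shared l r) <= K.
Proof. by move/small_rbag; apply: leq_trans; rewrite leq_exp2l // size_shared. Qed.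

Lemma size_xbag t p : small_bags t -> size (xbag t p) <= 5 * K.
Proof.
case: t => [b|l r] /=.
  move/small_rbag => /= bK; rewrite size_cat size_names.
  have := leq_trans (size_outer_of b) bK; move: bK.
  by move: (2 ^ _) (size (outer_of b)); clear; lia.
case/small_bags_join => lK rK; have sK := @small_shared l r rK.
move: lK rK => /small_rbag lK /small_rbag rK; rewrite !size_cat !size_names.
have := leq_trans (size_outer_of (rbag l)) lK; move: lK rK sK.
move: (2 ^ size (rbag l)) (2 ^ size (rbag r)) (2 ^ size (shared l r)).
by move: (size (outer_of _)); clear; lia.
Qed.

Lemma size_bags_tree t p b :
  small_bags t -> b \in bags (tree t p) -> size b <= 5 * K.
Proof.
elim: t p => [b'|l IHl r IHr] p tK.
  by rewrite inE => /eqP->; exact: size_xbag tK.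
rewrite bags_tree_join inE => /orP[/eqP->|]; first exact: size_xbag tK.
have [lK rK] := (small_bags_join l r).1 tK.
by rewrite mem_cat => /orP[/(IHl _ lK)|/(IHr _ rK)].
Qed.

End Sizes.

End Elimination.

(** * The reduced formula *)

Lemma prefix_true_cat pre rest body a :
  prefix_true (pre ++ rest) body a <-> prefix_true pre (prefix_true rest body) a.
Proof.
elim: pre a => [|[[] X] pre IHpre] a //=.
- by split=> -[b Hb]; exists b; apply/IHpre.
- by split=> Hb b; apply/IHpre.
Qed.

Lemma prefix_true_iff pre f g :
  (forall a, f a <-> g a) -> forall a, prefix_true pre f a <-> prefix_true pre g a.
Proof.
move=> fg; elim: pre => [|[[] X] pre IHpre] a //=.
- by split=> -[b Hb]; exists b; apply/IHpre.
- by split=> Hb b; apply/IHpre.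
Qed.

Definition units (u : seq var) : matrix := [seq [:: (true, x)] | x <- u].

Lemma td_uniq G T : tree_decomposition G T -> all uniq (bbags (bin_of T)).
Proof.
move=> T_td; apply/allP => b; rewrite bbags_bin_of => bT.
by have [] := td_bags T_td bT.
Qed.

Lemma small_bags_width T : small_bags (2 ^ (width T).+1) (bin_of T).
Proof.
move=> b; rewrite bbags_bin_of => bT.
(* [width] is a truncated predecessor, so its successor bounds the bag sizes even if all bags are
   empty. *)
rewrite leq_exp2l // /width (leq_trans _ (leqSpred _)) //.
by rewrite (big_rem b) //= leq_maxl.
Qed.

Section Reduct.

Variables (pre : seq block) (S1 S2 : seq var) (psi : matrix) (T : bagtree).

Let phi := QBF (pre ++ [:: (Exists, S1); (Forall, S2)]) psi.

Definition outer := flatten (map snd (pre ++ [:: (Exists, S1)])).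
Let O := outer.
Let F := flatten O.
Let t := bin_of T.

(** The units assert the claims for all assignments of the root bag. One of these assignments is the
    restriction of any given assignment of outer and universal variables, so together they say that
    the universal block cannot falsify [psi]. *)
Definition new_matrix : matrix :=
  units (rvars F [::] (rbag t)) ++ cls O psi F t [::].

Definition reduct : qbf :=
  QBF (pre ++ [:: (Exists, S1 ++ aux F t [::])]) new_matrix.

Definition new_tree : bagtree := tree O F t [::].

Hypothesis phi_wf : qbf_wf phi.
Hypothesis T_td : tree_decomposition (primal_graph phi) T.

(** The concatenation of all outer names is long enough, of linear length, and computed without
    comparing lengths. *)
Let OF : {in O, forall x, size x <= size F}.
Proof.
rewrite /F => x; elim: (O) => //= y s IHs; rewrite inE size_cat => /orP[/eqP->|/IHs].
  exact: leq_addr.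
by move=> h; rewrite (leq_trans h) // leq_addl.
Qed.

Let t_uniq : all uniq (bbags t) := td_uniq T_td.

Let t_conn x : conn x t.
Proof.
have [xV|xV] := boolP (x \in matrix_vars psi).
  by apply/conn_bin_of; apply: (td_connected T_td).
(* [td_connected] speaks about vertices only; other variables are in no bag and hence trivially
   connected. *)
have nocc : ~~ occ x t.
  apply/negP => /occP[b]; rewrite bbags_bin_of => bT xb.
  have [_ /(_ x xb)] := td_bags T_td bT; by rewrite /= (negbTE xV).
elim: (t) nocc => //= l IHl r IHr; rewrite negb_or => /andP[xl xr].
by rewrite IHl // IHr // (negbTE xl).
Qed.

Let matrix_varsP (m : matrix) x :
  reflect (exists2 c, c \in m & x \in map snd c) (x \in matrix_vars m).
Proof.
rewrite /matrix_vars mem_undup; apply: (iffP flattenP).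
  by case=> s /mapP[c cm ->] xc; exists c.
by case=> c cm xc; exists (map snd c) => //; apply: map_f.
Qed.

Let term_in_bag c : c \in psi -> exists2 b, b \in bbags t & {subset map snd c <= b}.
Proof.
move=> cp; apply: clique_in_bag => [x _|x y xc yc]; first exact: t_conn.
have xV : x \in matrix_vars psi by apply/matrix_varsP; exists c.
have yV : y \in matrix_vars psi by apply/matrix_varsP; exists c.
(* The primal graph has no loops, so the diagonal case relies on [td_vertices]. *)
have [<-|ne] := eqVneq x y.
  by have [b bT xb] := td_vertices T_td xV; exists b; rewrite ?bbags_bin_of // xb.
have [|b bT xyb] := @td_edges _ _ T_td x y xV yV.
  by rewrite /= ne; apply/hasP; exists c; rewrite ?xc.
by exists b; rewrite ?bbags_bin_of.
Qed.

Let vars_split x : x \in matrix_vars psi -> (x \in O) || (x \in S2).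
Proof.
have [_ H] := phi_wf; move/H.
by rewrite /O /outer /= !map_cat !flatten_cat /= !mem_cat !in_nil !orbF orbA.
Qed.

Let disj x : x \in O -> x \in S2 -> False.
Proof.
have [H _] := phi_wf; move: H.
rewrite /O /outer /= -[[:: _; _]]/([:: (Exists, S1)] ++ [:: (Forall, S2)]) catA.
rewrite map_cat flatten_cat cat_uniq => /and3P[_ /hasPn H _] xO xS.
by move: (H x); rewrite /= cats0 xS => /(_ isT)/negP; apply.
Qed.

Lemma mem_new_matrix_vars x :
  (x \in matrix_vars new_matrix) = has (fun b : seq var => x \in b) (bags new_tree).
Proof.
apply/matrix_varsP/hasP => [[c]|[b bt xb]]; last first.
  exists [:: (true, x); (false, x)]; last by rewrite mem_head.
  by rewrite mem_cat (bags_cls psi bt xb) orbT.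
rewrite mem_cat => /orP[/mapP[y yr ->]|ct].
  rewrite inE => /eqP->; exists (xbag O F t [::]); last exact: rvars_xbag.
  by rewrite /new_tree; case: (t) => *; exact: mem_head.
by have [b bt cb] := cls_sub t_uniq ct; move/cb; exists b.
Qed.

Lemma clause_in_bag c : c \in new_matrix ->
  exists2 b, b \in bags new_tree & {subset map snd c <= b}.
Proof.
rewrite mem_cat => /orP[/mapP[y yr ->]|]; last exact: cls_sub.
exists (xbag O F t [::]).
  by rewrite /new_tree; case: (t) => *; exact: mem_head.
by move=> x; rewrite inE => /eqP->; exact: rvars_xbag.
Qed.

Lemma reduct_td : tree_decomposition (primal_graph reduct) new_tree.
Proof.
split=> /=.
- move=> b bt; split; first exact: (allP (uniq_bags_tree OF [::] t_uniq)).
  by move=> x xb; rewrite mem_new_matrix_vars; apply/hasP; exists b.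
- by move=> x; rewrite mem_new_matrix_vars => /hasP[b]; exists b.
- move=> x y _ _ /andP[_ /hasP[c cm /andP[xc yc]]].
  by have [b bt cb] := clause_in_bag cm; exists b; rewrite ?cb.
- by move=> x _; apply/conn_bin_of; apply: conn_tree.
Qed.

Lemma reduct_wf : qbf_wf reduct.
Proof.
have eO : flatten (map snd (pre ++ [:: (Exists, S1 ++ aux F t [::])])) =
    O ++ aux F t [::].
  by rewrite /O /outer !map_cat !flatten_cat /= !cats0 catA.
split; rewrite /= eO.
  rewrite cat_uniq uniq_aux andbT; apply/andP; split.
    have [H _] := phi_wf; move: H.
    rewrite /= -[[:: _; _]]/([:: (Exists, S1)] ++ [:: (Forall, S2)]) catA.
    by rewrite map_cat flatten_cat cat_uniq => /andP[].
  by apply/hasPn => x /aux_fresh; apply.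
move=> x; rewrite mem_new_matrix_vars => /hasP[b bt xb]; rewrite mem_cat.
have /xocc_sub : xocc O F x t [::] by apply/flattenP; exists b.
by case/orP=> [->|/andP[->]]; rewrite ?orbT.
Qed.

(** A join bag consists of five lists of at most [2 ^ (k + 1)] variables each: claims before and
    after the join, claims of the child, shared claims, and outer variables. This gives
    [10 * 2 ^ k]. *)
Lemma reduct_width : width new_tree <= 12 * 2 ^ width T.
Proof.
have H b : b \in bags new_tree -> size b <= 5 * 2 ^ (width T).+1.
  by apply: size_bags_tree; exact: small_bags_width.
have : \max_(b <- bags new_tree) size b <= 5 * 2 ^ (width T).+1.
  by rewrite big_seq; elim/big_ind: _ => // x y; rewrite geq_max => -> ->.
by rewrite [width new_tree]/width expnS; move: (\max_(_ <- _) _) (2 ^ _); clear; lia.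
Qed.

(** The blocks before [S1] are the same in both formulas, so the equivalence is needed only below
    them, for a fixed assignment [a] of their variables. *)
Lemma reduct_step a :
  (exists b, forall b', dnf_true (override (override a b S1) b' S2) psi) <->
  (exists b, cnf_true (override a b (S1 ++ aux F t [::])) new_matrix).
Proof.
have notaux x : x \in O -> (x \in aux F t [::]) = false.
  by move=> xO; apply/negbTE/negP => /(aux_fresh OF); rewrite xO.
split=> [[b Hb]|[b Hb]].
  pose a1 := override a b S1.
  (* The new variables receive the values of the greatest solution under the outer assignment
     [a1]. *)
  exists (fun x => if x \in aux F t [::] then (true, x) \in env O psi F a1 t [::] else b x).
  set v := override _ _ _.
  have va : {in O, v =1 a1}.
    by move=> x xO; rewrite /v /a1 /override mem_cat notaux // orbF.
  have ve : {in env O psi F a1 t [::], forall l, v l.2 = l.1}.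
    move=> [c x] lc /=.
    have xa : x \in aux F t [::] by rewrite -(env_vars O psi F a1); exact: (map_f snd lc).
    rewrite /v /override mem_cat xa orbT.
    have := uniq_aux F t [::]; rewrite -(env_vars O psi F a1).
    (* Distinct names make the membership test in the witness a correct lookup in the table. *)
    elim: (env _ _ _ _ _ _) lc => //= -[c' y] s IHs.
    rewrite !inE !xpair_eqE => + /andP[ys us].
    case/orP=> [/andP[/eqP-> /eqP->]|lc].
      rewrite eqxx andbT; case: (c') => //=; apply: contraNF ys => ys'.
      exact: (map_f snd ys').
    have -> : (x == y) = false by apply: contraNF ys => /eqP<-; exact: (map_f snd lc).
    by rewrite andbF /=; exact: IHs.
  rewrite /cnf_true all_cat; apply/andP; split; last first.
    exact: env_satisfies va ve.
  apply/allP => c /mapP[x /mapP[al Aal ->] ->] /=; rewrite orbF /lit_true /=.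
  rewrite -/(nm F false [::] al).
  rewrite (ve (forced O psi a1 t al, nm F false [::] al)) /=; last first.
    case: (t) Aal => [?|? ?] Aal; rewrite mem_cat; apply/orP; left; apply/mapP; by exists al.
  (* A false root claim would give an assignment [A] falsifying every term that fits in a bag. But
     [Hb] provides a true term, and by the Helly property it fits in one. *)
  apply/eqP; apply: contraT => nv.
  have [A [_ Aa1 HA]] := not_forced t_uniq t_conn Aal nv.
  have /hasP[{}c cp /allP Hc] := Hb A.
  have [b' b't cb'] := term_in_bag cp.
  case/negP: (HA c b' cp b't cb'); apply/allP => -[s {}x] lc.
  have xV : x \in matrix_vars psi.
    by apply/matrix_varsP; exists c => //; exact: (map_f snd lc).
  have := Hc _ lc; rewrite /lit_true /= {1}/override; case: ifP => // xS.
  by have := vars_split xV; rewrite xS orbF => xO; rewrite Aa1.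
exists b => b'.
set A := override _ b' S2; set v := override a b _ in Hb.
pose a1 := override a b S1.
have Aa : {in O, A =1 a1}.
  by move=> x xO; rewrite /A {1}/override; case: ifP => // /disj; case.
have va : {in O, v =1 a1}.
  by move=> x xO; rewrite /v /a1 /override mem_cat notaux // orbF.
(* The claim used is the one for the restriction of [A] to the root bag, which a unit clause
   asserts. *)
apply: (forced_true Aa (t := t)).
move: Hb; rewrite /cnf_true all_cat => /andP[/allP Hu Hc].
apply: (satisfies_forced va Hc); first exact: restr_assigns.
have := Hu [:: (true, nm F false [::] (restr A (rbag t)))].
rewrite /= orbF /lit_true /= => /(_ _)/eqP; apply.
by apply/mapP; exists (nm F false [::] (restr A (rbag t))) => //; apply/map_f/restr_assigns.
Qed.

Lemma reduct_valid : qbf_valid phi <-> qbf_valid reduct.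
Proof.
rewrite /qbf_valid /=.
apply: (iff_trans (prefix_true_cat _ _ _ _)).
apply: (iff_trans _ (iff_sym (prefix_true_cat _ _ _ _))).
apply: prefix_true_iff => a.
by rewrite /= /matrix_true /= !last_cat /=; exact: reduct_step.
Qed.

End Reduct.

(** * Cost semantics *)

(** Costs are upper bounds, so that rules compose without exact counts of steps. *)
Definition ev (P : program) env e v (T : nat) : Prop :=
  exists2 t, eval P env e v t & t <= T.

Definition fn P f u v T := ev P [:: u] (body P f) v T.

Section EvalRules.

Variables (P : program) (env : seq data).

Lemma ev_var i : ev P env (EVar i) (nth Leaf env i) 1.
Proof. by exists 1 => //; constructor. Qed.

Lemma ev_leaf : ev P env ELeaf Leaf 1.
Proof. by exists 1 => //; constructor. Qed.

Lemma ev_pair e1 e2 v1 v2 T1 T2 :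
  ev P env e1 v1 T1 -> ev P env e2 v2 T2 ->
  ev P env (EPair e1 e2) (Pair v1 v2) (T1 + T2).+1.
Proof.
by move=> [t1 H1 ?] [t2 H2 ?]; exists (t1 + t2).+1; [constructor | lia].
Qed.

Lemma ev_case e e0 e1 u v T T' :
  ev P env e u T ->
  (match u with
   | Leaf => ev P env e0 v T'
   | Pair d1 d2 => ev P (d1 :: d2 :: env) e1 v T'
   end) ->
  ev P env (ECase e e0 e1) v (T + T').+1.
Proof.
case: u => [|d1 d2] [t1 H1 ?] [t2 H2 ?]; exists (t1 + t2).+1; try lia.
  exact: eval_case_leaf H1 H2.
exact: eval_case_pair H1 H2.
Qed.

(** The conclusion has the form of the second premise of [ev_case]. Charging for both branches keeps
    the cost independent of [b]. *)
Lemma ev_if b e0 e1 v0 v1 T0 T1 :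
  ev P env e0 v0 T0 -> ev P (Leaf :: Leaf :: env) e1 v1 T1 ->
  match enc_bool b with
  | Leaf => ev P env e0 (if b then v1 else v0) (T0 + T1)
  | Pair d1 d2 => ev P (d1 :: d2 :: env) e1 (if b then v1 else v0) (T0 + T1)
  end.
Proof.
by case: b => -[t0 H0 ?] [t1 H1 ?]; [exists t1 | exists t0] => //; lia.
Qed.

Lemma ev_let e1 e2 v1 v2 T1 T2 :
  ev P env e1 v1 T1 -> ev P (v1 :: env) e2 v2 T2 ->
  ev P env (ELet e1 e2) v2 (T1 + T2).+1.
Proof.
move=> [t1 H1 ?] [t2 H2 ?]; exists (t1 + t2).+1; last by lia.
exact: eval_let H1 H2.
Qed.

Lemma ev_call f e u v T T' :
  ev P env e u T -> fn P f u v T' -> ev P env (ECall f e) v (T + T').+1.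
Proof.
move=> [t1 H1 ?] [t2 H2 ?]; exists (t1 + t2).+1; last by lia.
exact: eval_call H1 H2.
Qed.

Lemma ev_eq e v v' T T' : ev P env e v T -> v = v' -> T <= T' -> ev P env e v' T'.
Proof. by move=> [t H ?] <- ?; exists t => //; lia. Qed.

End EvalRules.

(* Terms with de Bruijn levels: a term is applied to the size of its
   environment. *)
Definition term := nat -> expr.

Definition tvar (l : nat) : term := fun n => EVar (n - l.+1).
Definition tnil : term := fun _ => ELeaf.
Definition tpair (e1 e2 : term) : term := fun n => EPair (e1 n) (e2 n).
(** The first component of the pair has index 0 and hence the higher level. *)
Definition tcase (e e0 : term) (e1 : term -> term -> term) : term :=
  fun n => ECase (e n) (e0 n) (e1 (tvar n.+1) (tvar n) n.+2).
Definition tlet (e1 : term) (e2 : term -> term) : term :=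
  fun n => ELet (e1 n) (e2 (tvar n) n.+1).
Definition tcall (f : nat) (e : term) : term := fun n => ECall f (e n).
Definition tfun (e : term -> term) : expr := e (tvar 0) 1.

Definition tfalse : term := tnil.
Definition ttrue : term := tpair tnil tnil.

Notation "<< e , .. , e1 , e2 >>" := (tpair e .. (tpair e1 e2) ..)
  (at level 0, e at level 99, e1 at level 99, e2 at level 99).
Notation "'tif' e 'then' e1 'else' e0" := (tcase e e0 (fun _ _ => e1))
  (at level 200, e at level 99, e1 at level 99, e0 at level 200).
Notation "'unpair' ( x , y ) = e 'in' f" := (tcase e tnil (fun x y => f))
  (at level 200, x name, y name, e at level 99, f at level 200).

(* The function with index [f] computes a right fold over a list, given together
   with some context. *)
Definition tfold (f : nat) (z : term -> term) (g : term -> term -> term -> term) :=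
  tfun (fun u => tcase u tnil (fun c l =>
    tcase l (z c) (fun x l' =>
      tlet (tcall f (tpair c l')) (fun r => g c x r)))).

(** Symbolic execution: the head normal form of the expression selects the rule, value and cost
    remain existential variables, and calls are left to [spec]. *)
Ltac ev_step spec :=
  lazymatch goal with
  | |- ev ?P ?env ?e _ _ =>
      let e' := eval hnf in e in
      lazymatch e' with
      | EVar ?i =>
          let i' := eval vm_compute in i in
          let v := eval cbn [nth] in (nth Leaf env i') in
          exact (ev_var P env i' : ev P env e v 1)
      | ELeaf => exact (ev_leaf P env : ev P env e Leaf 1)
      | EPair _ _ => eapply ev_pair
      | ECase _ _ _ => eapply ev_case
      | ELet _ _ => eapply ev_let
      | ECall _ _ => eapply ev_call
      end
  | |- match enc_bool _ with _ => _ end => eapply ev_if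
  | |- match ?u with _ => _ end =>
      let u' := eval hnf in u in
      lazymatch u' with
      | Leaf => change u with Leaf
      | Pair ?a ?b => change u with (Pair a b)
      end; cbv beta iota
  | |- fn _ _ _ _ _ => spec
  end.

(** The splitting of [s] in the last premise identifies the accumulator and allows the cost [C] of a
    step to depend on bounds for the elements of [s]. *)
Lemma fn_fold P f z g (A B : Type) (encA : A -> data) (encB : B -> data) ctx
    (h : A -> B -> B) z0 s C :
  body P f = tfold f z g ->
  (forall l u, ev P [:: ctx; l; u] (z (tvar 2) 3) (encB z0) 20) ->
  (forall x s1 s2, s = s1 ++ x :: s2 -> forall l' l u,
     ev P [:: encB (foldr h z0 s2); encA x; l'; ctx; l; u]
       (g (tvar 2) (tvar 4) (tvar 5) 6) (encB (h x (foldr h z0 s2))) C) ->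
  fn P f (Pair ctx (enc_seq encA s)) (encB (foldr h z0 s))
    (size s * (C + 10) + 30).
Proof.
move=> Pf Hz; elim: s => [|x s IHs] Hg; rewrite /fn Pf.
  eapply ev_eq; [|reflexivity|].
    eapply ev_case; first exact: ev_var.
    rewrite /=.
    eapply ev_case; first exact: ev_var.
    exact: Hz.
  by rewrite /=; lia.
rewrite /fn in IHs; eapply ev_eq; [|reflexivity|].
  eapply ev_case; first exact: ev_var.
  rewrite /=.
  eapply ev_case; first exact: ev_var.
  rewrite /=.
  eapply ev_let.
    eapply ev_call; first by apply: ev_pair; exact: ev_var.
    apply: IHs => x' s1 s2 e; apply: (Hg x' (x :: s1)); by rewrite e.
  exact: (Hg x [::] s).
by rewrite /=; lia.
Qed.

(** * The program *)

Definition enc_lit : literal -> data := enc_pair enc_bool enc_var.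
Definition enc_lits : seq literal -> data := enc_seq enc_lit.
Definition enc_matrix : matrix -> data := enc_seq enc_lits.

Notation MAIN := 0 (only parsing).
Notation EQ := 1 (only parsing).
Notation MEM := 2 (only parsing).
Notation FILTER_IN := 3 (only parsing).
Notation FILTER_OUT := 4 (only parsing).
Notation CAT := 5 (only parsing).
Notation FLATTEN := 6 (only parsing).
Notation HOLDS := 7 (only parsing).
Notation PREFIX_ALL := 8 (only parsing).
Notation ASSIGNS := 9 (only parsing).
Notation BITS := 10 (only parsing).
Notation NAMES := 11 (only parsing).
Notation TAUTS := 12 (only parsing).
Notation LEAF_CLS := 13 (only parsing).
Notation JOIN_CLS_L := 14 (only parsing).
Notation JOIN_CLS_R := 15 (only parsing).
Notation UNITS := 16 (only parsing).
Notation OUTER := 17 (only parsing).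
Notation BLOCKS := 18 (only parsing).
Notation LEAF := 19 (only parsing).
Notation JOIN := 20 (only parsing).
Notation NODE := 21 (only parsing).

Definition p_eq := tfun (fun u =>
  unpair (x, y) = u in
  tcase x (tcase y ttrue (fun _ _ => tfalse)) (fun x1 x2 =>
    tcase y tfalse (fun y1 y2 =>
      tif tcall EQ << x1, y1 >> then tcall EQ << x2, y2 >> else tfalse))).

Definition p_mem := tfold MEM (fun _ => tfalse) (fun x y r =>
  tif tcall EQ << x, y >> then ttrue else r).

Definition p_filter_in := tfold FILTER_IN (fun _ => tnil) (fun s x r =>
  tif tcall MEM << x, s >> then << x, r >> else r).

Definition p_filter_out := tfold FILTER_OUT (fun _ => tnil) (fun s x r =>
  tif tcall MEM << x, s >> then r else << x, r >>).

(* The arguments of concatenation are swapped. *)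
Definition p_cat := tfold CAT (fun s => s) (fun _ x r => << x, r >>).
Definition tcat (e1 e2 : term) : term := tcall CAT << e2, e1 >>.

Definition p_flatten := tfold FLATTEN (fun _ => tnil) (fun _ x r => tcat x r).

Definition p_holds := tfold HOLDS (fun _ => tfalse) (fun a c r =>
  tif tcall EQ << tcall FILTER_IN << a, c >>, c >> then ttrue else r).

(** The context also carries a tail, so that one pass prefixes all lists and appends the result to
    it. *)
Definition p_prefix_all := tfold PREFIX_ALL
  (fun c => unpair (_, s) = c in s)
  (fun c a r => unpair (l, _) = c in << << l, a >>, r >>).

Definition p_assigns := tfold ASSIGNS (fun _ => << tnil, tnil >>) (fun _ x r =>
  tcall PREFIX_ALL
    << << << ttrue, x >>,
          tcall PREFIX_ALL << << << tfalse, x >>, tnil >>, r >> >>, r >>).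
Definition tassigns (b : term) := tcall ASSIGNS << tnil, b >>.

Definition p_bits := tfold BITS (fun _ => tnil) (fun _ l r =>
  unpair (c, _) = l in << c, r >>).

Definition tname (u a : term) := tcat u (tcall BITS << tnil, a >>).

Definition p_names := tfold NAMES (fun _ => tnil) (fun u a r =>
  << tname u a, r >>).

Definition p_tauts := tfold TAUTS (fun _ => tnil) (fun _ x r =>
  << << << ttrue, x >>, << tfalse, x >>, tnil >>, r >>).

Definition tlits (b : term) :=
  tcall FLATTEN << tnil, tcall TAUTS << tnil, b >> >>.

Definition p_leaf_cls := tfold LEAF_CLS (fun _ => tnil) (fun c a r =>
  unpair (u, c') = c in unpair (psi, lo) = c' in
  << << << tcall HOLDS << a, psi >>, tname u a >>,
        tcall FILTER_OUT << a, lo >> >>, r >>).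

Definition p_join_cls_l := tfold JOIN_CLS_L (fun _ => tnil) (fun c a r =>
  unpair (u, c') = c in unpair (u0, c'') = c' in unpair (us, ls) = c'' in
  << << << tfalse, tname u a >>, << ttrue, tname u0 a >>,
        << ttrue, tname us (tcall FILTER_IN << a, ls >>) >>, tnil >>, r >>).

Definition p_join_cls_r := tfold JOIN_CLS_R (fun _ => tnil) (fun c a r =>
  unpair (us, c') = c in unpair (u1, ls) = c' in
  << << << tfalse, tname us (tcall FILTER_IN << a, ls >>) >>,
        << ttrue, tname u1 a >>, tnil >>, r >>).

Definition p_units := tfold UNITS (fun _ => tnil) (fun _ x r =>
  << << << ttrue, x >>, tnil >>, r >>).

(* The result is [Leaf] until the innermost block has been skipped, and then a
   pair whose first component is the list of variables of the others. *)
Definition p_outer := tfold OUTER (fun _ => tnil) (fun _ q r =>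
  tcase r << tnil, tnil >> (fun s _ =>
    unpair (_, x) = q in << tcat x s, tnil >>)).

(* The result is [Leaf], then [Pair Leaf Leaf], and then a pair whose first
   component is the list of blocks, as blocks are processed inside out. *)
Definition p_blocks := tfold BLOCKS (fun _ => tnil) (fun s q r =>
  tcase r << tnil, tnil >> (fun p _ =>
    tcase p
      (unpair (e, x) = q in << << << e, tcat x s >>, tnil >>, tnil >>)
      (fun _ _ => << << q, p >>, tnil >>))).

Definition tprefix_r w := << tfalse, tfalse, w >>.
Definition tprefix_s w := << tfalse, ttrue, w >>.
Definition tpath_l w := << ttrue, tfalse, w >>.
Definition tpath_r w := << ttrue, ttrue, w >>.

(* [LEAF] and [JOIN] return the bag, the clauses and the new variables that
   belong to the root. *)
Definition p_leaf := tfun (fun i =>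
  unpair (c, i') = i in unpair (o, psi) = c in unpair (w, b) = i' in
  tlet (tassigns b) (fun s =>
  tlet (tcall FILTER_IN << o, b >>) (fun out =>
  tlet (tcall NAMES << tprefix_r w, s >>) (fun r =>
  tlet (tcat r out) (fun bag =>
  << bag,
     tcat (tcall LEAF_CLS << << tprefix_r w, psi, tlits out >>, s >>)
          (tcall TAUTS << tnil, bag >>),
     r >>))))).

Definition p_join := tfun (fun i =>
  unpair (o, i') = i in unpair (w, i'') = i' in unpair (b, b1) = i'' in
  tlet (tassigns b) (fun s =>
  tlet (tassigns b1) (fun s1 =>
  tlet (tcall FILTER_IN << b, b1 >>) (fun d =>
  tlet (tlits d) (fun ls =>
  tlet (tcall NAMES << tprefix_r w, s >>) (fun r =>
  tlet (tcall NAMES << tprefix_s w, tassigns d >>) (fun rs =>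
  tlet (tcat r (tcat (tcall NAMES << tprefix_r (tpath_l w), s >>)
               (tcat (tcall NAMES << tprefix_r (tpath_r w), s1 >>)
               (tcat rs (tcall FILTER_IN << o, b >>))))) (fun bag =>
  << bag,
     tcat (tcat (tcall JOIN_CLS_L << << tprefix_r w, tprefix_r (tpath_l w),
                                        tprefix_s w, ls >>, s >>)
                (tcall JOIN_CLS_R << << tprefix_s w, tprefix_r (tpath_r w),
                                        ls >>, s1 >>))
          (tcall TAUTS << tnil, bag >>),
     tcat r rs >>)))))))).

(** Binary trees are never built as data: the call for [b] with the remaining children plays the
    role of the left part of a join. *)
Definition p_node := tfun (fun i =>
  unpair (c, i') = i in unpair (w, t) = i' in unpair (b, ts) = t in
  tcase ts
    (unpair (bag, x) = tcall LEAF << c, w, b >> in unpair (cl, new) = x in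
     << << bag, tnil >>, cl, new >>)
    (fun t1 ts' =>
     unpair (o, _) = c in unpair (b1, _) = t1 in
     unpair (bag, x) = tcall JOIN << o, w, b, b1 >> in unpair (cl, new) = x in
     unpair (tl, x) = tcall NODE << c, tpath_l w, b, ts' >> in
     unpair (cl0, new0) = x in
     unpair (tr, x) = tcall NODE << c, tpath_r w, t1 >> in
     unpair (cl1, new1) = x in
     << << bag, tl, tr, tnil >>, tcat cl (tcat cl0 cl1),
        tcat new (tcat new0 new1) >>)).

Definition p_main := tfun (fun i =>
  unpair (phi, t) = i in unpair (pre, psi) = phi in unpair (b, _) = t in
  unpair (o, _) = tcall OUTER << tnil, pre >> in
  (* This is the code of the empty path: the end marker followed by [F]. *)
  tlet << tfalse, tcall FLATTEN << tnil, o >> >> (fun w =>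
  unpair (t', x) = tcall NODE << << o, psi >>, w, t >> in
  unpair (cl, new) = x in
  unpair (pre', _) = tcall BLOCKS << new, pre >> in
  << << pre',
        tcat (tcall UNITS << tnil, tcall NAMES << tprefix_r w, tassigns b >> >>)
             cl >>,
     t' >>)).

Definition prog : program :=
  [:: p_main; p_eq; p_mem; p_filter_in; p_filter_out; p_cat; p_flatten; p_holds;
      p_prefix_all; p_assigns; p_bits; p_names; p_tauts; p_leaf_cls;
      p_join_cls_l; p_join_cls_r; p_units; p_outer; p_blocks; p_leaf; p_join;
      p_node].

(** * Correctness and cost of the program *)

Ltac ev_run spec := eapply ev_eq; [solve [repeat ev_step spec] | | ].

Fixpoint eqd (x y : data) : bool :=
  match x, y with
  | Leaf, Leaf => true
  | Pair x1 x2, Pair y1 y2 => eqd x1 y1 && eqd x2 y2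
  | _, _ => false
  end.

Lemma eqdP x y : reflect (x = y) (eqd x y).
Proof.
elim: x y => [|x1 IH1 x2 IH2] [|y1 y2] /=; try by constructor.
by apply: (iffP andP) => [[/IH1-> /IH2->]|[/IH1 ? /IH2 ?]].
Qed.

Lemma fn_eq x y : fn prog EQ (Pair x y) (enc_bool (eqd x y)) (20 * data_size x).
Proof.
elim: x y => [|x1 IH1 x2 IH2] [|y1 y2].
- by ev_run fail.
- by ev_run fail.
- by ev_run fail; rewrite //=; lia.
- ev_run ltac:(first [exact: IH1|exact: IH2]); rewrite /=; last by lia.
  by case: (eqd _ _).
Qed.

Lemma data_size_gt0 d : 0 < data_size d.
Proof. by case: d. Qed.

Section EncSeq.

Variables (A : Type) (enc : A -> data).

Lemma data_size_cat s1 s2 :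
  (data_size (enc_seq enc (s1 ++ s2))).+1 =
  data_size (enc_seq enc s1) + data_size (enc_seq enc s2).
Proof. by elim: s1 => //= x s1; lia. Qed.

Lemma size_lt_data s : size s < data_size (enc_seq enc s).
Proof. by elim: s => //= x s; have := data_size_gt0 (enc x); lia. Qed.

Lemma data_size_mem s1 x s2 :
  data_size (enc x) + data_size (enc_seq enc s2) < data_size (enc_seq enc (s1 ++ x :: s2)).
Proof. by elim: s1 => //= y s1; lia. Qed.

End EncSeq.

Lemma fold_cost n C m D E :
  n <= m -> C + 10 <= D -> 30 <= E -> n * (C + 10) + 30 <= m * D + E.
Proof. by move=> nm CD CE; rewrite leq_add // leq_mul. Qed.

Section Specs.

(** [M] bounds quantities that are linear in the input size; [K], introduced below, bounds the
    number of assignments of a bag. The two are kept apart so that all costs stay linear in [K]. *)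
Variable M : nat.

Section Generic.

Variables (A : eqType) (enc : A -> data).
Hypothesis encI : injective enc.

Lemma eqd_enc x y : eqd (enc x) (enc y) = (x == y).
Proof. by apply/eqdP/eqP => [/encI|->]. Qed.

Definition c_mem := M * (20 * M + 40) + 40.

Lemma fn_mem x s :
  data_size (enc x) <= M -> size s <= M ->
  fn prog MEM (Pair (enc x) (enc_seq enc s)) (enc_bool (x \in s)) c_mem.
Proof.
move=> xM sM; eapply ev_eq;
  first eapply (fn_fold (encB := enc_bool)
  (h := fun y r => if x == y then true else r) (z0 := false) (C := 20 * M + 20)); first by [].
- by move=> l u; ev_run fail.
- move=> y s1 s2 _ l' l u; ev_run ltac:(exact: fn_eq); last by lia.
  by rewrite eqd_enc; case: eqP.
- by congr enc_bool; elim: (s) => //= y s' ->; rewrite inE; case: eqP.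
- by apply: fold_cost; lia.
Qed.

Definition c_filter := M * (c_mem + 40) + 40.

Lemma fn_filter_in s t :
  size s <= M -> data_size (enc_seq enc t) <= M ->
  fn prog FILTER_IN (Pair (enc_seq enc s) (enc_seq enc t))
    (enc_seq enc [seq x <- t | x \in s]) c_filter.
Proof.
move=> sM tM; eapply ev_eq;
  first eapply (fn_fold (encB := enc_seq enc)
  (h := fun y r => if y \in s then y :: r else r) (z0 := [::]) (C := c_mem + 30)); first by [].
- by move=> l u; ev_run fail.
- move=> y s1 s2 e l' l u; have := data_size_mem enc s1 y s2; rewrite -e => yM.
  ev_run ltac:(apply: fn_mem; [lia|exact: sM]); last by lia.
  by case: (_ \in _).
- by [].
- by have := size_lt_data enc t => ?; apply: fold_cost; lia.
Qed.

Lemma fn_filter_out s t :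
  size s <= M -> data_size (enc_seq enc t) <= M ->
  fn prog FILTER_OUT (Pair (enc_seq enc s) (enc_seq enc t))
    (enc_seq enc [seq x <- t | x \notin s]) c_filter.
Proof.
move=> sM tM; eapply ev_eq;
  first eapply (fn_fold (encB := enc_seq enc)
  (h := fun y r => if y \notin s then y :: r else r) (z0 := [::]) (C := c_mem + 30)); first by [].
- by move=> l u; ev_run fail.
- move=> y s1 s2 e l' l u; have := data_size_mem enc s1 y s2; rewrite -e => yM.
  ev_run ltac:(apply: fn_mem; [lia|exact: sM]); last by lia.
  by case: (_ \in _).
- by [].
- by have := size_lt_data enc t => ?; apply: fold_cost; lia.
Qed.

End Generic.

Lemma fn_cat (A : Type) (enc : A -> data) s t :
  fn prog CAT (Pair (enc_seq enc t) (enc_seq enc s)) (enc_seq enc (s ++ t))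
    (size s * 20 + 40).
Proof.
eapply ev_eq;
  first eapply (fn_fold (encB := enc_seq enc) (h := cons) (z0 := t) (C := 10)); first by [].
- by move=> l u; ev_run fail.
- by move=> y s1 s2 e l' l u; ev_run fail.
- by congr enc_seq; elim: (s) => //= x s' ->. 
- by lia.
Qed.

Definition c_flatten := M * (M * 20 + 80) + 40.

Lemma fn_flatten (A : Type) (enc : A -> data) ss :
  data_size (enc_seq (enc_seq enc) ss) <= M ->
  fn prog FLATTEN (Pair Leaf (enc_seq (enc_seq enc) ss)) (enc_seq enc (flatten ss))
    c_flatten.
Proof.
move=> sM; eapply ev_eq;
  first eapply (fn_fold (encB := enc_seq enc) (h := cat) (z0 := [::])
   (C := M * 20 + 60)); first by [].
- by move=> l u; ev_run fail.
- move=> y s1 s2 e l' l u; have := data_size_mem (enc_seq enc) s1 y s2; rewrite -e => yM.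
  ev_run ltac:(exact: fn_cat); first by [].
  by have := size_lt_data enc y; lia.
- by [].
- by have := size_lt_data (enc_seq enc) ss => ?; apply: fold_cost; lia.
Qed.

Lemma enc_bool_inj : injective enc_bool.
Proof. by case=> [] []. Qed.

Lemma enc_seq_inj (A : Type) (enc : A -> data) : injective enc -> injective (enc_seq enc).
Proof. by move=> eI; elim=> [|x s IHs] [|y t] //= [/eI-> /IHs->]. Qed.

Lemma enc_var_inj : injective enc_var.
Proof. exact: enc_seq_inj enc_bool_inj. Qed.

Lemma enc_lit_inj : injective enc_lit.
Proof. by move=> [b x] [c y] [/enc_bool_inj/= -> /enc_var_inj/= ->]. Qed.

Lemma enc_lits_inj : injective enc_lits.
Proof. exact: enc_seq_inj enc_lit_inj. Qed.

Definition c_holds := M * (c_filter + 20 * M + 60) + 40.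

Lemma data_size_filter (A : Type) (enc : A -> data) p s :
  data_size (enc_seq enc (filter p s)) <= data_size (enc_seq enc s).
Proof. by elim: s => //= x s; case: (p x) => /=; lia. Qed.

Lemma fn_holds psi a :
  size a <= M -> data_size (enc_matrix psi) <= M ->
  fn prog HOLDS (Pair (enc_lits a) (enc_matrix psi)) (enc_bool (holds psi a)) c_holds.
Proof.
move=> aM pM; eapply ev_eq;
  first eapply (fn_fold (encB := enc_bool) (encA := enc_lits)
   (h := fun c r => if sel c a == c then true else r) (z0 := false)
   (C := c_filter + 20 * M + 40)); first by [].
- by move=> l u; ev_run fail.
- move=> c s1 s2 e l' l u; have := data_size_mem enc_lits s1 c s2; rewrite -e => cM.
  have cM' : data_size (enc_lits c) <= M by rewrite /enc_matrix in pM; lia.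
  ev_run ltac:(first [exact: fn_eq |
    apply: (fn_filter_in enc_lit_inj aM); exact: cM']).
    by rewrite (eqd_enc enc_lits_inj) /sel; case: eqP.
  have := leq_trans (data_size_filter enc_lit (fun x => x \in a) c) cM'.
  rewrite -[enc_seq enc_lit]/enc_lits; move: (data_size _) c_filter; clear; lia.
- by congr enc_bool; rewrite /holds; elim: (psi) => //= c s ->; case: eqP.
- by have := size_lt_data enc_lits psi; rewrite -/enc_matrix => ?; apply: fold_cost; lia.
Qed.

Lemma fn_prefix_all l (t s : seq (seq literal)) :
  fn prog PREFIX_ALL (Pair (Pair (enc_lit l) (enc_matrix t)) (enc_matrix s))
    (enc_matrix (map (cons l) s ++ t)) (size s * 40 + 40).
Proof.
eapply ev_eq;
  first eapply (fn_fold (encB := enc_matrix)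
  (h := fun a r => (l :: a) :: r) (z0 := t) (C := 20)); first by [].
- by move=> ? u; ev_run fail.
- by move=> y s1 s2 e l' ? u; ev_run fail.
- by congr enc_matrix; elim: (s) => //= a s' ->.
- by lia.
Qed.

Variable K : nat.

Definition c_assigns := K * (M * 200 + 20).

Lemma fn_assigns b :
  data_size (enc_vars b) <= M -> 2 ^ size b <= K ->
  fn prog ASSIGNS (Pair Leaf (enc_vars b)) (enc_matrix (assigns b)) c_assigns.
Proof.
move=> bM bK; have K_gt0 : 0 < K by rewrite (leq_trans _ bK) // expn_gt0.
eapply ev_eq;
  first eapply (fn_fold (encB := enc_matrix) (encA := enc_var)
  (h := fun x r => map (cons (true, x)) r ++ map (cons (false, x)) r ++ [::])
  (z0 := [:: [::]]) (C := K * 40 + 140)); first by [].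
- by move=> ? u; ev_run fail.
- move=> x s1 s2 e l' l u.
  have -> : foldr (fun x r => map (cons (true, x)) r ++ map (cons (false, x)) r ++ [::])
     [:: [::]] s2 = assigns s2 by elim: (s2) => //= y s ->; rewrite cats0.
  ev_run ltac:(first [exact: (fn_prefix_all (false, _) [::]) | exact: (fn_prefix_all (true, _))]).
    by [].
  (* The tail [s2] lacks at least [x], so doubling its number of assignments does not exceed that of
     [b]. *)
  have : size (assigns s2) * 2 <= K.
    rewrite size_assigns -expnSr (leq_trans _ bK) // leq_exp2l // e size_cat /=; lia.
  by lia.
- by congr enc_matrix; elim: (b) => //= y s ->; rewrite cats0.
- by have := size_lt_data enc_var b; rewrite -/enc_vars /c_assigns => ?; nia.
Qed.

Lemma fn_bits (a : seq literal) :
  fn prog BITS (Pair Leaf (enc_lits a)) (enc_var (map fst a)) (size a * 40 + 40).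
Proof.
eapply ev_eq;
  first eapply (fn_fold (encB := enc_var) (encA := enc_lit)
  (h := fun (l : literal) r => l.1 :: r) (z0 := [::]) (C := 20)); first by [].
- by move=> ? u; ev_run fail.
- by move=> [c x] s1 s2 e l' ? u; ev_run fail.
- by elim: (a) => //= l s' [->].
- by lia.
Qed.

Definition c_name := M * 60 + 100.

Lemma ev_name env eu ea u a Tu Ta n :
  size u <= M -> size a <= M ->
  ev prog env (eu n) (enc_var u) Tu -> ev prog env (ea n) (enc_lits a) Ta ->
  ev prog env (tname eu ea n) (enc_var (u ++ map fst a)) (Tu + Ta + c_name).
Proof.
move=> uM aM Hu Ha; eapply ev_eq.
  eapply ev_call.
    eapply ev_pair; last exact: Hu.
    eapply ev_call; last exact: fn_bits.
    eapply ev_pair; first exact: ev_leaf.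
    exact: Ha.
  exact: fn_cat.
- by [].
- by rewrite /c_name; lia.
Qed.

Definition c_names := K * (c_name + 40) + 40.

Lemma fn_names u (s : seq (seq literal)) :
  size u <= M -> {in s, forall a, size a <= M} -> size s <= K ->
  fn prog NAMES (Pair (enc_var u) (enc_matrix s)) (enc_vars (names u s)) c_names.
Proof.
move=> uM aM sK; eapply ev_eq;
  first eapply (fn_fold (encB := enc_vars) (encA := enc_lits)
  (h := fun a r => (u ++ map fst a) :: r) (z0 := [::]) (C := c_name + 20)); first by [].
- by move=> ? v; ev_run fail.
- move=> a s1 s2 e l' l v.
  have {}aM : size a <= M by apply: aM; rewrite e mem_cat mem_head orbT.
  eapply ev_eq.
    apply: ev_pair; last by ev_step fail.
    by apply: (ev_name uM aM); ev_step fail.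
  + by [].
  + by lia.
- by [].
- by apply: fold_cost; lia.
Qed.

Lemma fn_tauts b :
  fn prog TAUTS (Pair Leaf (enc_vars b)) (enc_matrix (tauts b)) (size b * 60 + 40).
Proof.
eapply ev_eq;
  first eapply (fn_fold (encB := enc_matrix) (encA := enc_var)
  (h := fun x r => [:: (true, x); (false, x)] :: r) (z0 := [::]) (C := 40)); first by [].
- by move=> ? v; ev_run fail.
- by move=> x s1 s2 e l' l v; ev_run fail.
- by [].
- by lia.
Qed.

Lemma data_size_tauts b :
  data_size (enc_matrix (tauts b)) <= 12 * data_size (enc_vars b).
Proof. by elim: b => //= x b; rewrite /enc_matrix /enc_vars; lia. Qed.

Lemma data_size_lits b :
  data_size (enc_lits (lits b)) <= 12 * data_size (enc_vars b).
Proof. by elim: b => //= x b; rewrite /lits /enc_lits /enc_vars /=; lia. Qed.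

Definition c_leaf_cls := K * (c_holds + c_name + c_filter + 80) + 40.

Lemma fn_leaf_cls u psi lo (s : seq (seq literal)) :
  size u <= M -> data_size (enc_matrix psi) <= M -> data_size (enc_lits lo) <= M ->
  {in s, forall a, size a <= M} -> size s <= K ->
  fn prog LEAF_CLS
    (Pair (Pair (enc_var u) (Pair (enc_matrix psi) (enc_lits lo))) (enc_matrix s))
    (enc_matrix [seq (holds psi a, u ++ map fst a) :: [seq l <- lo | l \notin a]
                | a <- s])
    c_leaf_cls.
Proof.
move=> uM pM lM aM sK; eapply ev_eq;
  first eapply (fn_fold (encB := enc_matrix) (encA := enc_lits)
  (h := fun a r => ((holds psi a, u ++ map fst a) :: [seq l <- lo | l \notin a]) :: r)
  (z0 := [::]) (C := c_holds + c_name + c_filter + 50)); first by [].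
- by move=> ? v; ev_run fail.
- move=> a s1 s2 e l' l v.
  have {}aM : size a <= M by apply: aM; rewrite e mem_cat mem_head orbT.
  ev_run ltac:(first [exact: fn_holds | exact: (fn_filter_out enc_lit_inj)
    | exact: fn_bits | exact: fn_cat]).
  + by [].
  + by rewrite /c_name; lia.
- by [].
- by apply: fold_cost; lia.
Qed.

Definition c_join_cls := K * (3 * c_name + c_filter + 120) + 40.

Lemma fn_join_cls_l u u0 us ls (s : seq (seq literal)) :
  size u <= M -> size u0 <= M -> size us <= M -> data_size (enc_lits ls) <= M ->
  {in s, forall a, size a <= M} -> size s <= K ->
  fn prog JOIN_CLS_L
    (Pair (Pair (enc_var u) (Pair (enc_var u0) (Pair (enc_var us) (enc_lits ls))))
          (enc_matrix s))
    (enc_matrix [seq [:: (false, u ++ map fst a); (true, u0 ++ map fst a);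
                         (true, us ++ map fst (sel ls a))] | a <- s])
    c_join_cls.
Proof.
move=> uM u0M usM lM aM sK; eapply ev_eq;
  first eapply (fn_fold (encB := enc_matrix) (encA := enc_lits)
  (h := fun a r => [:: (false, u ++ map fst a); (true, u0 ++ map fst a);
                         (true, us ++ map fst (sel ls a))] :: r)
  (z0 := [::]) (C := 3 * c_name + c_filter + 100)); first by [].
- by move=> ? v; ev_run fail.
- move=> a s1 s2 e l' l v.
  have {}aM : size a <= M by apply: aM; rewrite e mem_cat mem_head orbT.
  have sM : size (sel ls a) <= M.
    rewrite size_filter (leq_trans (count_size _ _)) //.
    by rewrite (leq_trans _ lM) // ltnW // (size_lt_data enc_lit).
  ev_run ltac:(first [exact: (fn_filter_in enc_lit_inj) | exact: fn_bits | exact: fn_cat]).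
  + by [].
  + rewrite /c_name; move: sM; rewrite /sel.
    by move: (size [seq _ <- _ | _]) c_filter => S F; lia.
- by [].
- by apply: fold_cost; lia.
Qed.

Lemma fn_join_cls_r us u1 ls (s : seq (seq literal)) :
  size u1 <= M -> size us <= M -> data_size (enc_lits ls) <= M ->
  {in s, forall a, size a <= M} -> size s <= K ->
  fn prog JOIN_CLS_R
    (Pair (Pair (enc_var us) (Pair (enc_var u1) (enc_lits ls))) (enc_matrix s))
    (enc_matrix [seq [:: (false, us ++ map fst (sel ls a)); (true, u1 ++ map fst a)]
                | a <- s])
    c_join_cls.
Proof.
move=> u0M usM lM aM sK; eapply ev_eq;
  first eapply (fn_fold (encB := enc_matrix) (encA := enc_lits)
  (h := fun a r => [:: (false, us ++ map fst (sel ls a)); (true, u1 ++ map fst a)] :: r)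
  (z0 := [::]) (C := 3 * c_name + c_filter + 100)); first by [].
- by move=> ? v; ev_run fail.
- move=> a s1 s2 e l' l v.
  have {}aM : size a <= M by apply: aM; rewrite e mem_cat mem_head orbT.
  have sM : size (sel ls a) <= M.
    rewrite size_filter (leq_trans (count_size _ _)) //.
    by rewrite (leq_trans _ lM) // ltnW // (size_lt_data enc_lit).
  ev_run ltac:(first [exact: (fn_filter_in enc_lit_inj) | exact: fn_bits | exact: fn_cat]).
  + by [].
  + rewrite /c_name; move: sM; rewrite /sel.
    by move: (size [seq _ <- _ | _]) c_filter => S F; lia.
- by [].
- by apply: fold_cost; lia.
Qed.

Lemma fn_units b :
  fn prog UNITS (Pair Leaf (enc_vars b)) (enc_matrix (units b)) (size b * 40 + 40).
Proof.
eapply ev_eq;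
  first eapply (fn_fold (encB := enc_matrix) (encA := enc_var)
  (h := fun x r => [:: (true, x)] :: r) (z0 := [::]) (C := 30)); first by [].
- by move=> ? v; ev_run fail.
- by move=> x s1 s2 e l' l v; ev_run fail.
- by [].
- by lia.
Qed.

Definition enc_block : block -> data := enc_pair enc_quantifier enc_vars.

Definition enc_opt (A : Type) (enc : A -> data) (o : option A) : data :=
  if o is Some x then Pair (enc x) Leaf else Leaf.

Definition c_outer := M * (M * 20 + 100) + 40.

Lemma fn_outer pre S1 S2 :
  let pre' := pre ++ [:: (Exists, S1); (Forall, S2)] in
  data_size (enc_seq enc_block pre') <= M ->
  fn prog OUTER (Pair Leaf (enc_seq enc_block pre'))
    (Pair (enc_vars (outer pre S1)) Leaf) c_outer.
Proof.
move=> pre' pM.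
pose h (q : block) r := if r is Some s then Some (q.2 ++ s) else Some [::].
eapply ev_eq;
  first eapply (fn_fold (encB := enc_opt enc_vars) (encA := enc_block)
  (h := h) (z0 := None)
  (C := M * 20 + 90)); first by [].
- by move=> ? v; ev_run fail.
- move=> [q x] s1 s2 e l' l v; have := data_size_mem enc_block s1 (q, x) s2; rewrite -e.
  rewrite -[data_size (enc_block _)]/
    (data_size (enc_quantifier q) + data_size (enc_vars x)).+1.
  have := size_lt_data enc_var x; rewrite -/enc_vars => H1 H2.
  case: (foldr _ _ _) => [s|].
    ev_run ltac:(exact: fn_cat); first by [].
    by rewrite /=; lia.
  by ev_run fail; [by [] | lia].
- rewrite /pre' foldr_cat /= cats0 /outer map_cat flatten_cat /= cats0.
  suff -> : forall s, foldr h (Some s) pre = Some (flatten (map snd pre) ++ s) by [].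
  by move=> s; elim: (pre) => //= q p ->; rewrite /h /= catA.
- by have := size_lt_data enc_block pre' => ?; apply: fold_cost; lia.
Qed.

Lemma fn_blocks pre S1 S2 new :
  let pre' := pre ++ [:: (Exists, S1); (Forall, S2)] in
  data_size (enc_seq enc_block pre') <= M ->
  fn prog BLOCKS (Pair (enc_vars new) (enc_seq enc_block pre'))
    (Pair (enc_seq enc_block (pre ++ [:: (Exists, S1 ++ new)])) Leaf) c_outer.
Proof.
move=> pre' pM.
pose h (q : block) r := if r is Some s then
  Some (if s is [::] then [:: (q.1, q.2 ++ new)] else q :: s) else Some [::].
eapply ev_eq;
  first eapply (fn_fold (encB := enc_opt (enc_seq enc_block)) (encA := enc_block)
  (h := h) (z0 := None) (C := M * 20 + 90)); first by [].
- by move=> ? v; ev_run fail.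
- move=> [q x] s1 s2 e l' l v; have := data_size_mem enc_block s1 (q, x) s2; rewrite -e.
  rewrite -[data_size (enc_block _)]/
    (data_size (enc_quantifier q) + data_size (enc_vars x)).+1.
  have := size_lt_data enc_var x; rewrite -/enc_vars => H1 H2.
  case: (foldr _ _ _) => [[|b s]|].
  + ev_run ltac:(exact: fn_cat); first by [].
    by rewrite /=; lia.
  + by ev_run fail; [by [] | lia].
  + by ev_run fail; [by [] | lia].
- rewrite /pre' foldr_cat /=.
  suff -> : forall b s, foldr h (Some (b :: s)) pre = Some (pre ++ b :: s) by [].
  by move=> b s; elim: (pre) => //= q p ->; case: p.
- by have := size_lt_data enc_block pre' => ?; apply: fold_cost; lia.
Qed.

End Specs.

(** * Processing the nodes of the decomposition *)

Section NodeSpecs.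

Variables M K : nat.

Variables (O : seq var) (psi : matrix) (F : seq bool).
Hypothesis O_le : size O <= M.
Hypothesis psi_le : data_size (enc_matrix psi) <= M.

Lemma assigns_le b :
  size b <= M -> {in assigns b, forall a, size a <= M}.
Proof. by move=> bM a; rewrite mem_assigns => /eqP e; rewrite -e size_map in bM. Qed.

Definition c_leaf :=
  c_assigns M K + c_filter M + c_names M K + c_flatten M + c_leaf_cls M K +
  500 * K + 200 * M + 500.

Definition c_join :=
  3 * c_assigns M K + 2 * c_filter M + 4 * c_names M K + c_flatten M +
  2 * c_join_cls M K + 1000 * K + 200 * M + 1000.

Lemma fn_leaf p b :
  12 * data_size (enc_vars b) <= M -> 2 ^ size b <= K ->
  size (path_code F p) + 4 <= M ->
  fn prog LEAF
    (Pair (Pair (enc_vars O) (enc_matrix psi))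
          (Pair (enc_var (path_code F p)) (enc_vars b)))
    (Pair (enc_vars (xbag O F (BLeaf b) p))
       (Pair (enc_matrix (own_cls O psi F (BLeaf b) p ++ tauts (xbag O F (BLeaf b) p)))
             (enc_vars (rvars F p b)))) c_leaf.
Proof.
move=> bM bK pM.
have dM : data_size (enc_vars b) <= M by lia.
have oM : data_size (enc_matrix (tauts (outer_of O b))) <= M.
  have := data_size_filter enc_var (fun x => x \in O) b.
  have := data_size_tauts (outer_of O b).
  by rewrite -/enc_vars -/(outer_of O b); lia.
have lM : data_size (enc_lits (lits (outer_of O b))) <= M.
  have := data_size_filter enc_var (fun x => x \in O) b.
  have := data_size_lits (outer_of O b).
  by rewrite -/enc_vars -/(outer_of O b); lia.
have sb : size b <= M by rewrite (leq_trans _ dM) // ltnW // (size_lt_data enc_var).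
have sA : size (assigns b) <= K by rewrite size_assigns.
have AM := assigns_le sb.
have uM : size (name_prefix F false p) <= M by rewrite /=; lia.
have so : size (outer_of O b) <= M.
  by rewrite size_filter (leq_trans (count_size _ _)).
ev_run ltac:(first
  [ exact: (fn_assigns dM bK)
  | exact: (fn_filter_in enc_var_inj O_le dM)
  | exact: (fn_names uM AM sA)
  | exact: (fn_flatten oM)
  | exact: fn_tauts
  | exact: (fn_leaf_cls uM psi_le lM AM sA)
  | exact: (fn_cat enc_var (rvars F p b) (outer_of O b))
  | exact: (fn_cat (enc_lits) (own_cls O psi F (BLeaf b) p) (tauts (xbag O F (BLeaf b) p)))]).
- by [].
- have := size_names (name_prefix F false p) b; rewrite -/(rvars F p b) /= => sr.
  rewrite ?size_cat ?size_map ?sr size_assigns /c_leaf.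
  move: (size (outer_of O b)) (2 ^ size b) bK so.
  move: (c_assigns _ _) (c_filter _) (c_names _ _) (c_flatten _) (c_leaf_cls _ _).
  by clear; lia.
Qed.

Lemma fn_join p l r :
  12 * data_size (enc_vars (rbag l)) <= M -> 2 ^ size (rbag l) <= K ->
  12 * data_size (enc_vars (rbag r)) <= M -> 2 ^ size (rbag r) <= K ->
  size (path_code F p) + 4 <= M ->
  fn prog JOIN
    (Pair (enc_vars O)
          (Pair (enc_var (path_code F p))
                (Pair (enc_vars (rbag l)) (enc_vars (rbag r)))))
    (Pair (enc_vars (xbag O F (BJoin l r) p))
       (Pair (enc_matrix (own_cls O psi F (BJoin l r) p ++ tauts (xbag O F (BJoin l r) p)))
             (enc_vars (rvars F p (rbag l) ++ svars F p l r)))) c_join.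
Proof.
move=> lM lK rM rK pM.
have dlM : data_size (enc_vars (rbag l)) <= M by lia.
have drM : data_size (enc_vars (rbag r)) <= M by lia.
have ds : data_size (enc_vars (shared l r)) <= data_size (enc_vars (rbag r)).
  exact: data_size_filter.
have dsM : data_size (enc_vars (shared l r)) <= M by lia.
have sK : 2 ^ size (shared l r) <= K by rewrite (leq_trans _ rK) // leq_exp2l // size_shared.
have tM : data_size (enc_matrix (tauts (shared l r))) <= M.
  by have := data_size_tauts (shared l r); lia.
have lsM : data_size (enc_lits (lits (shared l r))) <= M.
  by have := data_size_lits (shared l r); lia.
have sz b : data_size (enc_vars b) <= M -> size b <= M.
  by move=> bM; rewrite (leq_trans _ bM) // ltnW // (size_lt_data enc_var).
have AM := assigns_le (sz _ dlM); have BM := assigns_le (sz _ drM).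
have DM := assigns_le (sz _ dsM).
have slK : size (assigns (rbag l)) <= K by rewrite size_assigns.
have srK : size (assigns (rbag r)) <= K by rewrite size_assigns.
have sdK : size (assigns (shared l r)) <= K by rewrite size_assigns.
have uM : size (name_prefix F false p) <= M by rewrite /=; lia.
have usM : size (name_prefix F true p) <= M by rewrite /=; lia.
have u0M : size (name_prefix F false (false :: p)) <= M by rewrite /=; lia.
have u1M : size (name_prefix F false (true :: p)) <= M by rewrite /=; lia.
ev_run ltac:(first
  [ exact: (fn_assigns dlM lK)
  | exact: (fn_assigns drM rK)
  | exact: (fn_assigns dsM sK)
  | exact: (fn_filter_in enc_var_inj O_le dlM)
  | exact: (fn_filter_in enc_var_inj (sz _ dlM) drM)
  | exact: (fn_names uM AM slK)
  | exact: (fn_names usM DM sdK)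
  | exact: (fn_names u0M AM slK)
  | exact: (fn_names u1M BM srK)
  | exact: (fn_flatten tM)
  | exact: fn_tauts
  | exact: (fn_join_cls_l uM u0M usM lsM AM slK)
  | exact: (fn_join_cls_r u1M usM lsM BM srK)
  | exact: (fn_cat enc_var)
  | exact: (fn_cat enc_lits)]).
- by [].
- have sn u b : size (names u (assigns b)) = 2 ^ size b by exact: size_names.
  rewrite ?size_cat ?size_map ?sn ?size_assigns /c_join.
  have so : size [seq x <- rbag l | x \in O] <= K by exact: leq_trans (size_outer_of O _) lK.
  have st : size [seq x <- rbag r | x \in rbag l] <= M.
    by rewrite -/(shared l r); exact: sz.
  rewrite -[shared l r]/[seq x <- rbag r | x \in rbag l] in sK.
  move: (2 ^ size (rbag l)) (2 ^ size (rbag r)) (2 ^ size _) lK rK sK.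
  move: (size [seq x <- rbag l | _]) (size [seq x <- rbag r | _]) so st.
  move: (c_assigns _ _) (c_filter _) (c_names _ _) (c_flatten _) (c_join_cls _ _).
  by clear; lia.
Qed.

Fixpoint bin_size (t : bintree) : nat :=
  if t is BJoin l r then (bin_size l + bin_size r).+1 else 1.

Lemma bin_size_gt0 t : 0 < bin_size t.
Proof. by case: t. Qed.

(** Each node contributes at most [2 * K] clauses of its own and a tautology for each of at most
    [5 * K] bag variables. *)
Lemma size_cls t p : small_bags K t -> size (cls O psi F t p) <= bin_size t * (7 * K).
Proof.
elim: t p => [b|l IHl r IHr] p tK; have tB := size_xbag O F p tK.
  have /small_rbag /= bK := tK.
  rewrite cats0 size_cat !size_map size_assigns; move: tB bK.
  by rewrite /=; move: (2 ^ _) (size _); clear; lia.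
have [lK rK] := (small_bags_join _ l r).1 tK.
have := IHl (false :: p) lK; have := IHr (true :: p) rK.
have := small_rbag lK; have := small_rbag rK; move: tB.
have -> : size (cls O psi F (BJoin l r) p) =
    2 ^ size (rbag l) + 2 ^ size (rbag r) + (size (xbag O F (BJoin l r) p) +
    (size (cls O psi F l (false :: p)) + size (cls O psi F r (true :: p)))).
  rewrite size_cat size_cat size_cat [size (own_cls _ _ _ _ _)]size_cat.
  by rewrite !size_map !size_assigns.
rewrite -[bin_size (BJoin l r)]/(bin_size l + bin_size r).+1.
move: (size (xbag _ _ _ _)) (size (cls _ _ _ l _)) (size (cls _ _ _ r _)).
move: (2 ^ size (rbag l)) (2 ^ size (rbag r)); clear; nia.
Qed.

Lemma size_aux t p : small_bags K t -> size (aux F t p) <= bin_size t * (2 * K).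
Proof.
elim: t p => [b|l IHl r IHr] p tK.
  by have /small_rbag /= := tK; rewrite size_names; move: (2 ^ _); clear; lia.
have [lK rK] := (small_bags_join _ l r).1 tK.
have := IHl (false :: p) lK; have := IHr (true :: p) rK.
have := small_rbag lK; have := @small_shared K l r rK.
rewrite -[bin_size (BJoin l r)]/(bin_size l + bin_size r).+1.
rewrite -[aux F (BJoin l r) p]/(rvars F p (rbag l) ++ svars F p l r ++
  aux F l (false :: p) ++ aux F r (true :: p)).
rewrite !size_cat !size_names.
move: (size (aux _ _ _)) (size (aux _ _ _)) (2 ^ _) (2 ^ _); clear; nia.
Qed.

Definition c_node := c_leaf + c_join + M * (K * 200) + K * 300 + 300.

(** The hypothesis on the path code is an invariant: a step down adds two bits to the code and
    leaves at least two nodes of the tree behind. *)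
Lemma fn_node t p :
  {in bbags (bin_of t), forall b, 12 * data_size (enc_vars b) <= M} ->
  small_bags K (bin_of t) ->
  size (path_code F p) + 2 * bin_size (bin_of t) + 2 <= M ->
  fn prog NODE
    (Pair (Pair (enc_vars O) (enc_matrix psi))
          (Pair (enc_var (path_code F p)) (enc_bagtree t)))
    (Pair (enc_bagtree (tree O F (bin_of t) p))
       (Pair (enc_matrix (cls O psi F (bin_of t) p))
             (enc_vars (aux F (bin_of t) p)))) (bin_size (bin_of t) * c_node).
Proof.
elim/bagtree_ind2: t p => [b|b t ts IHt IHts] p tM tK pM.
  have bM : 12 * data_size (enc_vars b) <= M by apply: tM; exact: mem_head.
  have bK : 2 ^ size b <= K by apply: tK; exact: mem_head.
  have pM' : size (path_code F p) + 4 <= M by move: pM; rewrite /=; lia.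
  have H := fn_leaf bM bK pM'.
  rewrite -[enc_bagtree _]/(Pair (enc_vars b) Leaf).
  ev_run ltac:(exact: H).
    by rewrite [cls _ _ _ _ _]/= cats0.
  by rewrite /c_node [bin_size _]/=; lia.
have eb : rbag (bin_of (Node b ts)) = b by exact: rbag_bin_of.
case: t IHt tM tK pM => [b1 ts1] IHt.
set l := bin_of (Node b ts) in eb IHts *; set r := bin_of (Node b1 ts1) in IHt *.
rewrite -[bin_of _]/(BJoin l r) => tM tK pM.
have er : rbag r = b1 by exact: rbag_bin_of.
have [lK rK] := (small_bags_join _ l r).1 tK.
have lM : {in bbags l, forall b, 12 * data_size (enc_vars b) <= M}.
  by move=> b' b'l; apply: tM; rewrite mem_cat b'l.
have rM : {in bbags r, forall b, 12 * data_size (enc_vars b) <= M}.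
  by move=> b' b'r; apply: tM; rewrite mem_cat b'r orbT.
have pl : size (path_code F (false :: p)) + 2 * bin_size l + 2 <= M.
  by move: pM; rewrite /=; have := bin_size_gt0 r; lia.
have pr : size (path_code F (true :: p)) + 2 * bin_size r + 2 <= M.
  by move: pM; rewrite /=; have := bin_size_gt0 l; lia.
have pj : size (path_code F p) + 4 <= M.
  by move: pM; rewrite /=; have := bin_size_gt0 l; have := bin_size_gt0 r; lia.
have Hl := IHts (false :: p) lM lK pl.
have Hr := IHt (true :: p) rM rK pr.
have Hj := fn_join (lM _ (rbag_in l)) (small_rbag lK) (rM _ (rbag_in r)) (small_rbag rK) pj.
rewrite eb er in Hj.
rewrite -[enc_bagtree _]/(Pair (enc_vars b)
  (Pair (Pair (enc_vars b1) (enc_seq enc_bagtree ts1)) (enc_seq enc_bagtree ts))).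
ev_run ltac:(first [exact: Hl | exact: Hr | exact: Hj
  | exact: (fn_cat enc_lits) | exact: (fn_cat enc_var)]).
  have -> : cls O psi F (BJoin l r) p =
    (own_cls O psi F (BJoin l r) p ++ tauts (xbag O F (BJoin l r) p)) ++
    (cls O psi F l (false :: p) ++ cls O psi F r (true :: p)) by rewrite -catA.
  have -> : aux F (BJoin l r) p = (rvars F p b ++ svars F p l r) ++
    (aux F l (false :: p) ++ aux F r (true :: p)) by rewrite -catA -eb.
  by [].
have tlM : bin_size l <= M by lia.
have sl := leq_trans (size_cls (false :: p) lK) (leq_mul tlM (leqnn _)).
have al := leq_trans (size_aux (false :: p) lK) (leq_mul tlM (leqnn _)).
have ol : size (own_cls O psi F (BJoin l r) p) <= 2 * K.
  rewrite size_cat !size_map !size_assigns.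
  by move: (small_rbag lK) (small_rbag rK); move: (2 ^ _) (2 ^ _); clear; lia.
have bl : size (tauts (xbag O F (BJoin l r) p)) <= 5 * K.
  by rewrite size_map; exact: size_xbag.
have nl : size (rvars F p b ++ svars F p l r) <= 2 * K.
  rewrite size_cat !size_names; have := small_rbag lK; rewrite eb.
  by move: (@small_shared K l r rK); move: (2 ^ _) (2 ^ _); clear; lia.
rewrite [size (own_cls _ _ _ _ _ ++ _)]size_cat.
have -> : bin_size (BJoin l r) * c_node = c_leaf + c_join + M * (K * 200) + K * 300 + 300 +
    (bin_size l * c_node + bin_size r * c_node) by rewrite mulSn mulnDl.
move: (size _) (size _) (size _) (size _) (size _) sl al ol bl nl.
move: (bin_size l * c_node) (bin_size r * c_node) c_leaf c_join; clear; nia.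
Qed.

End NodeSpecs.

(** * Size of the output *)

Lemma data_size_seq_le (A : eqType) (enc : A -> data) s m :
  {in s, forall x, data_size (enc x) <= m} ->
  data_size (enc_seq enc s) <= size s * m.+1 + 1.
Proof.
elim: s => //= x s IHs H; have := H x (mem_head _ _).
have := IHs (fun y ys => H y (mem_behead (s := x :: s) ys)).
by move: (data_size _) (data_size _) (size s); clear; nia.
Qed.

Lemma data_size_var x : data_size (enc_var x) <= 4 * size x + 1.
Proof.
by elim: x => //= c x; rewrite /enc_var; case: c => /=; lia.
Qed.

Lemma data_size_in (A : eqType) (enc : A -> data) x s :
  x \in s -> data_size (enc x) <= data_size (enc_seq enc s).
Proof.
by case/path.splitPr => s1 s2; have := data_size_mem enc s1 x s2; lia.
Qed.

Lemma data_size_outer pre S1 S2 :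
  data_size (enc_vars (outer pre S1)) <=
  data_size (enc_seq enc_block (pre ++ [:: (Exists, S1); (Forall, S2)])).
Proof.
rewrite /outer map_cat flatten_cat /= cats0; elim: pre => [|[q x] pre IHpre] /=.
  by rewrite /enc_block /=; lia.
rewrite -catA; have := data_size_cat enc_var x (flatten (map snd pre) ++ S1).
by move: IHpre; rewrite /enc_block /enc_vars /enc_pair /=; lia.
Qed.

Lemma size_flatten_vars O : size (flatten O) <= data_size (enc_vars O).
Proof.
elim: O => //= x O; rewrite size_cat; have := size_lt_data enc_bool x.
by rewrite /enc_vars /= /enc_var; lia.
Qed.

Lemma data_size_bag t b : b \in bags t -> data_size (enc_vars b) <= data_size (enc_bagtree t).
Proof.
rewrite -bbags_bin_of; elim/bagtree_ind2: t => [b'|b' t ts IHt IHts] /=.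
  by rewrite inE => /eqP->; lia.
by rewrite mem_cat => /orP[/IHts|/IHt]; rewrite /=; lia.
Qed.

Lemma bin_size_le t : bin_size (bin_of t) <= data_size (enc_bagtree t).
Proof.
elim/bagtree_ind2: t => [b'|b' t ts IHt IHts] /=; first by lia.
by move: IHts; rewrite /=; lia.
Qed.

Section Main.

Variables (M K : nat).
Variables (pre : seq block) (S1 S2 : seq var) (psi : matrix) (T : bagtree).

Let pre' := pre ++ [:: (Exists, S1); (Forall, S2)].
Let O := outer pre S1.
Let F := flatten O.
Let t := bin_of T.

Hypothesis pre_le : data_size (enc_seq enc_block pre') <= M.
Hypothesis psi_le : data_size (enc_matrix psi) <= M.
(** The factor 12 pays for passing from a bag to its tautologies or literals. *)
Hypothesis bags_le : {in bbags t, forall b, 12 * data_size (enc_vars b) <= M}.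
Hypothesis bags_K : small_bags K t.
Hypothesis F_le : size F + 2 * bin_size t + 4 <= M.

Let O_le : data_size (enc_vars O) <= M.
Proof. exact: leq_trans (data_size_outer _ _ _) pre_le. Qed.

Definition c_main :=
  2 * c_outer M + c_flatten M + M * c_node M K + c_assigns M K +
  c_names M K + 100 * K + 200.

Lemma fn_main :
  fn prog MAIN (enc_instance (QBF pre' psi) T)
    (enc_instance (reduct pre S1 psi T) (new_tree pre S1 T)) c_main.
Proof.
have sO : size O <= M by rewrite (leq_trans _ O_le) // ltnW // (size_lt_data enc_var).
have pM : size (path_code F [::]) + 2 * bin_size t + 2 <= M by rewrite /=; lia.
have Hn := fn_node sO psi_le bags_le bags_K pM.
have tK := small_rbag bags_K.
have tM : data_size (enc_vars (rbag t)) <= M by have := bags_le (rbag_in t); lia.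
have uM : size (name_prefix F false [::]) <= M by rewrite /=; lia.
have AM : {in assigns (rbag t), forall a, size a <= M}.
  by apply: assigns_le; rewrite (leq_trans _ tM) // ltnW // (size_lt_data enc_var).
have AK : size (assigns (rbag t)) <= K by rewrite size_assigns.
rewrite -[enc_instance (QBF _ _) T]/
  (Pair (Pair (enc_seq enc_block pre') (enc_matrix psi)) (enc_bagtree T)).
case eT: T => [b ts].
have eb : rbag t = b by rewrite /t eT rbag_bin_of.
rewrite eb in tK tM AM AK; rewrite -{2}eT.
have FM : data_size (enc_seq (enc_seq enc_bool) O) <= M := O_le.
rewrite eT in Hn.
ev_run ltac:(first
  [ exact: (fn_outer pre_le)
  | exact: (fn_flatten FM)
  | exact: Hn
  | exact: (fn_blocks _ pre_le)
  | exact: (fn_assigns tM tK)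
  | exact: (fn_names uM AM AK)
  | exact: fn_units
  | exact: (fn_cat enc_lits)]).
  rewrite /enc_instance /reduct /new_tree /new_matrix -/O -/F -/t eb /t eT.
  by [].
have : bin_size t * c_node M K <= M * c_node M K by rewrite leq_mul2r; apply/orP; right; lia.
rewrite /t eT /c_main !size_map size_assigns.
move: (c_outer _) (c_flatten _) (c_assigns _ _) (c_names _ _) (2 ^ _) tK.
by move: (bin_size _ * _) (M * _); clear; lia.
Qed.

Let bag_size b : b \in bbags t -> size b <= M.
Proof.
move=> bt; apply: leq_trans (bags_le bt).
by rewrite (leq_trans (ltnW (size_lt_data enc_var b))) // leq_pmull.
Qed.

Lemma size_nm_le u b x : size b <= M -> x \in names u (assigns b) -> size x <= size u + M.
Proof. by move=> bM /mapP[a /(assigns_le bM) aM ->]; rewrite size_cat size_map leq_add2l. Qed.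

Lemma size_aux_var t' p x :
  {in bbags t', forall b, size b <= M} -> x \in aux F t' p ->
  size x <= size (path_code F p) + 2 * bin_size t' + M.
Proof.
elim: t' p => [b|l IHl r IHr] p bM /=.
  by move/(size_nm_le (bM _ (mem_head _ _))); rewrite /=; lia.
have lM : {in bbags l, forall b, size b <= M}.
  by move=> b bl; apply: bM; rewrite mem_cat bl.
have rM : {in bbags r, forall b, size b <= M}.
  by move=> b br; apply: bM; rewrite mem_cat br orbT.
have sM : size (shared l r) <= M.
  by rewrite (leq_trans (size_shared _ _)) // rM // rbag_in.
have := bin_size_gt0 l; have := bin_size_gt0 r.
rewrite !mem_cat => ? ? /or4P[/(size_nm_le (lM _ (rbag_in l)))|/(size_nm_le sM)
  |/(IHl _ lM)|/(IHr _ rM)]; by rewrite /=; lia.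
Qed.

(** Names have at most [2 * M + 2] bits, and a bit adds at most 4 to the size of the encoding. *)
Definition c_var := 8 * M + 9.

Let aux_var x : x \in aux F t [::] -> data_size (enc_var x) <= c_var.
Proof.
move/(size_aux_var bag_size) => /= sx; have := data_size_var x.
by rewrite /c_var; lia.
Qed.

Let O_var x : x \in O -> data_size (enc_var x) <= c_var.
Proof.
by move/(data_size_in enc_var); rewrite -/enc_vars /c_var; lia.
Qed.

Let bag_var b x : b \in bags (new_tree pre S1 T) -> x \in b -> data_size (enc_var x) <= c_var.
Proof.
move=> bt xb; have /xocc_sub : xocc O F x t [::] by apply/flattenP; exists b.
by case/orP=> [/aux_var|/andP[/O_var]].
Qed.

(** A leaf clause has its head and at most two literals per variable of the bag; a join clause has
    at most three literals. *)
Lemma size_clause t' p c :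
  {in bbags t', forall b, size b <= M} -> c \in cls O psi F t' p -> size c <= 2 * M + 3.
Proof.
have taut b : c \in tauts b -> size c <= 2 * M + 3.
  by case/mapP=> x _ -> /=; lia.
elim: t' p => [b|l IHl r IHr] p bM.
  rewrite /= cats0 mem_cat => /orP[/mapP[a _ ->] /=|/taut //].
  have := bM b (mem_head _ _).
  have : size (lits (outer_of O b)) = 2 * size (outer_of O b).
    by elim: (outer_of O b) => //= x s; rewrite /lits /= => ->; lia.
  have : size (outer_of O b) <= size b by rewrite size_filter count_size.
  have : size (blockers O b a) <= size (lits (outer_of O b)).
    by rewrite size_filter count_size.
  by move: (size _) (size _) (size _) (size _); clear; lia.
have lM : {in bbags l, forall b, size b <= M}.
  by move=> b bl; apply: bM; rewrite mem_cat bl.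
have rM : {in bbags r, forall b, size b <= M}.
  by move=> b br; apply: bM; rewrite mem_cat br orbT.
rewrite [cls _ _ _ _ _]/= mem_cat => /orP[|].
  by rewrite mem_cat => /orP[] /mapP[a _ ->] /=; lia.
rewrite !mem_cat => /or3P[/taut//|/(IHl _ lM)//|/(IHr _ rM)//].
Qed.

Definition c_clause := (2 * M + 3) * (c_var + 6) + 1.

Lemma data_size_clause c :
  size c <= 2 * M + 3 -> {in map snd c, forall x, data_size (enc_var x) <= c_var} ->
  data_size (enc_lits c) <= c_clause.
Proof.
move=> sc cV; have := @data_size_seq_le _ enc_lit c (c_var + 5).
rewrite -/enc_lits => /(_ _)/leq_trans; apply.
  move=> [s x] lc; have := cV x (map_f snd lc).
  by rewrite /enc_lit /enc_pair /=; case: (s) => /=; lia.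
by rewrite /c_clause -addnS leq_add2r leq_mul.
Qed.

Lemma data_size_new_matrix :
  all uniq (bbags t) ->
  data_size (enc_matrix (new_matrix pre S1 psi T)) <=
  (K + M * (7 * K)) * (c_clause + 1) + 1.
Proof.
move=> ut; have := @data_size_seq_le _ enc_lits (new_matrix pre S1 psi T) c_clause.
rewrite -/enc_matrix => /(_ _)/leq_trans; apply.
  move=> c; rewrite mem_cat => /orP[/mapP[x xr ->]|ct].
    apply: data_size_clause => [|y]; first by rewrite /=; lia.
    by rewrite inE => /eqP->; apply/aux_var/rvars_aux.
  have [b bt cb] := cls_sub ut ct.
  apply: data_size_clause => [|x /cb]; first exact: size_clause ct.
  exact: bag_var.
rewrite leq_add2r addn1 leq_mul // size_cat leq_add //.
  by rewrite size_map size_names; exact: small_rbag.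
by rewrite (leq_trans (size_cls _ _ _ _ bags_K)) // leq_mul //; lia.
Qed.

Lemma data_size_tree V t' p :
  small_bags K t' ->
  {in bags (tree O F t' p), forall b : seq var,
    {in b, forall x, data_size (enc_var x) <= V}} ->
  data_size (enc_bagtree (tree O F t' p)) <= bin_size t' * (5 * K * (V + 1) + 6).
Proof.
have bag t0 p0 b : small_bags K t0 -> b \in bags (tree O F t0 p0) ->
    {in b, forall x, data_size (enc_var x) <= V} ->
    data_size (enc_vars b) <= 5 * K * (V + 1) + 1.
  move=> tK bt bV; have := @data_size_seq_le _ enc_var b V bV.
  rewrite -/enc_vars => /leq_trans; apply; rewrite leq_add2r addn1 leq_mul2r.
  by rewrite (size_bags_tree tK bt) orbT.
elim: t' p => [b|l IHl r IHr] p tK V_le.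
  have bt : xbag O F (BLeaf b) p \in bags (tree O F (BLeaf b) p) by exact: mem_head.
  have := bag _ _ _ tK bt (V_le _ bt).
  rewrite -[enc_bagtree _]/(Pair (enc_vars (xbag O F (BLeaf b) p)) Leaf) /=.
  by move: (_ * (V + 1)); clear; lia.
have [lK rK] := (small_bags_join _ l r).1 tK.
have bt : xbag O F (BJoin l r) p \in bags (tree O F (BJoin l r) p) by exact: mem_head.
have := bag _ _ _ tK bt (V_le _ bt).
have lV : {in bags (tree O F l (false :: p)), forall b : seq var,
    {in b, forall x, data_size (enc_var x) <= V}}.
  by move=> b bl; apply: V_le; rewrite bags_tree_join inE mem_cat bl orbT.
have rV : {in bags (tree O F r (true :: p)), forall b : seq var,
    {in b, forall x, data_size (enc_var x) <= V}}.
  by move=> b br; apply: V_le; rewrite bags_tree_join inE mem_cat br !orbT.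
have := IHl (false :: p) lK lV; have := IHr (true :: p) rK rV.
rewrite -[enc_bagtree (tree O F (BJoin l r) p)]/(Pair (enc_vars (xbag O F (BJoin l r) p))
  (Pair (enc_bagtree (tree O F l (false :: p)))
     (Pair (enc_bagtree (tree O F r (true :: p))) Leaf))).
rewrite -[bin_size (BJoin l r)]/(bin_size l + bin_size r).+1 /=.
move: (data_size _) (data_size _) (data_size _) (_ * (V + 1)); clear; nia.
Qed.

Definition c_output :=
  M * (2 * K) * (c_var + 1) + (K + M * (7 * K)) * (c_clause + 1) +
  M * (5 * K * (c_var + 1) + 6) + M + 10.

Lemma data_size_output :
  all uniq (bbags t) ->
  data_size (enc_instance (reduct pre S1 psi T) (new_tree pre S1 T)) <= c_output.
Proof.
move=> ut.
have tM : bin_size t <= M by move: F_le; lia.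
have Hc := data_size_new_matrix ut.
have Ht := data_size_tree bags_K (fun b bt x => @bag_var b x bt).
have Hp : data_size (enc_seq enc_block (pre ++ [:: (Exists, S1 ++ aux F t [::])])) <=
    M + data_size (enc_vars (aux F t [::])).
  apply: leq_trans (leq_add pre_le (leqnn _)).
  have := data_size_cat enc_block pre [:: (Exists, S1); (Forall, S2)].
  have := data_size_cat enc_block pre [:: (Exists, S1 ++ aux F t [::])].
  have := data_size_cat enc_var S1 (aux F t [::]).
  rewrite -/pre' /enc_block /enc_pair /= -/enc_vars; lia.
have Ha : data_size (enc_vars (aux F t [::])) <= M * (2 * K) * (c_var + 1) + 1.
  apply: leq_trans (data_size_seq_le aux_var) _.
  rewrite leq_add2r addn1 leq_mul // (leq_trans (size_aux _ _ bags_K)) //.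
  by rewrite leq_mul.
have {}Ht : data_size (enc_bagtree (new_tree pre S1 T)) <= M * (5 * K * (c_var + 1) + 6).
  by rewrite (leq_trans Ht) // leq_mul.
rewrite -[data_size (enc_instance _ _)]/((data_size (enc_seq enc_block
  (pre ++ [:: (Exists, S1 ++ aux F t [::])])) + data_size (enc_matrix (new_matrix pre S1 psi T))).+1
  + data_size (enc_bagtree (new_tree pre S1 T))).+1.
rewrite /c_output; move: Hp Ha Hc Ht.
move: (data_size _) (data_size _) (data_size _) (data_size _).
move: (M * (2 * K) * _) ((_ + _) * _) (M * (_ + 6)); clear; lia.
Qed.

End Main.

(** * Polynomial bounds *)

Definition poly_bounded (f : nat -> nat) :=
  exists c d, forall n, 0 < n -> f n <= c * n ^ d.

(** The bound is linear in [K], as a higher power of [2 ^ k] would leave the class [O^*(2 ^ k)].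
    Accordingly, such functions are multiplied only by polynomials in [n]. *)
Definition fpt_bounded (f : nat -> nat -> nat) :=
  exists c d, forall n K, 0 < n -> 0 < K -> f n K <= c * n ^ d * K.

Lemma poly_const c : poly_bounded (fun=> c).
Proof. by exists c, 0 => n _; rewrite muln1. Qed.

Lemma poly_id : poly_bounded id.
Proof. by exists 1, 1 => n _; rewrite mul1n. Qed.

Lemma leq_monomial c d1 d2 n : 0 < n -> c * n ^ d1 <= c * n ^ (d1 + d2).
Proof. by move=> n0; rewrite leq_mul2l leq_pexp2l ?orbT // leq_addr. Qed.

Lemma poly_add f g :
  poly_bounded f -> poly_bounded g -> poly_bounded (fun n => f n + g n).
Proof.
move=> [c1 [d1 H1]] [c2 [d2 H2]]; exists (c1 + c2), (d1 + d2) => n n0.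
rewrite mulnDl leq_add // ?(leq_trans (H1 n n0)) ?(leq_trans (H2 n n0)) //.
  exact: leq_monomial.
by rewrite addnC leq_monomial.
Qed.

Lemma poly_mul f g :
  poly_bounded f -> poly_bounded g -> poly_bounded (fun n => f n * g n).
Proof.
move=> [c1 [d1 H1]] [c2 [d2 H2]]; exists (c1 * c2), (d1 + d2) => n n0.
by rewrite expnD mulnACA leq_mul ?H1 ?H2.
Qed.

Lemma fpt_poly f : poly_bounded f -> fpt_bounded (fun n _ => f n).
Proof.
move=> [c [d H]]; exists c, d => n K n0 K0.
by rewrite (leq_trans (H n n0)) // leq_pmulr.
Qed.

Lemma fpt_param : fpt_bounded (fun _ K => K).
Proof. by exists 1, 0 => n K _ _; rewrite muln1 mul1n. Qed.

Lemma fpt_add f g :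
  fpt_bounded f -> fpt_bounded g -> fpt_bounded (fun n K => f n K + g n K).
Proof.
move=> [c1 [d1 H1]] [c2 [d2 H2]]; exists (c1 + c2), (d1 + d2) => n K n0 K0.
rewrite mulnDl mulnDl leq_add // ?(leq_trans (H1 n K n0 K0)) ?(leq_trans (H2 n K n0 K0)) //.
  by rewrite leq_mul2r leq_monomial ?orbT.
by rewrite leq_mul2r addnC leq_monomial ?orbT.
Qed.

Lemma fpt_mul f g :
  poly_bounded f -> fpt_bounded g -> fpt_bounded (fun n K => f n * g n K).
Proof.
move=> [c1 [d1 H1]] [c2 [d2 H2]]; exists (c1 * c2), (d1 + d2) => n K n0 K0.
by rewrite expnD mulnACA -mulnA leq_mul ?H1 ?H2.
Qed.

Lemma fpt_mulr f g :
  fpt_bounded f -> poly_bounded g -> fpt_bounded (fun n K => f n K * g n).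
Proof.
move=> fb gb; have [c [d H]] := fpt_mul gb fb.
by exists c, d => n K n0 K0; rewrite mulnC H.
Qed.

Lemma fpt_scale m f :
  fpt_bounded f -> 0 < m -> fpt_bounded (fun n K => f (m * n) K).
Proof.
move=> [c [d H]] m0; exists (c * m ^ d), d => n K n0 K0.
by rewrite -(mulnA c) -expnMn H // muln_gt0 m0.
Qed.

Create HintDb bounds.

(* Unification produces eta-reduced functions. *)
Ltac poly :=
  first
  [ exact poly_id
  | solve [auto with bounds nocore]
  | lazymatch goal with |- poly_bounded ?h =>
      change (poly_bounded (fun n => h n)); cbv beta
    end;
    lazymatch goal with
    | |- poly_bounded (fun _ => ?c) => exact (poly_const c)
    | |- poly_bounded (fun n => @?f n + @?g n) => apply (@poly_add f g); poly
    | |- poly_bounded (fun n => @?f n * @?g n) => apply (@poly_mul f g); poly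
    end ].

Ltac fpt :=
  first
  [ exact fpt_param
  | solve [auto with bounds nocore]
  | lazymatch goal with |- fpt_bounded ?h =>
      change (fpt_bounded (fun n K => h n K)); cbv beta
    end;
    lazymatch goal with
    | |- fpt_bounded (fun n K => @?f n K + @?g n K) => apply (@fpt_add f g); fpt
    | |- fpt_bounded (fun n K => @?f n * @?g n K) => apply (@fpt_mul f g); [poly | fpt]
    | |- fpt_bounded (fun n K => @?f n K * @?g n) => apply (@fpt_mulr f g); [fpt | poly]
    | |- fpt_bounded (fun n _ => @?f n) => apply (@fpt_poly f); poly
    end ].

Lemma poly_c_mem : poly_bounded c_mem.
Proof. rewrite /c_mem; poly. Qed.
#[local] Hint Resolve poly_c_mem : bounds.

Lemma poly_c_filter : poly_bounded c_filter.
Proof. rewrite /c_filter; poly. Qed.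
#[local] Hint Resolve poly_c_filter : bounds.

Lemma poly_c_flatten : poly_bounded c_flatten.
Proof. rewrite /c_flatten; poly. Qed.
#[local] Hint Resolve poly_c_flatten : bounds.

Lemma poly_c_holds : poly_bounded c_holds.
Proof. rewrite /c_holds; poly. Qed.
#[local] Hint Resolve poly_c_holds : bounds.

Lemma poly_c_name : poly_bounded c_name.
Proof. rewrite /c_name; poly. Qed.
#[local] Hint Resolve poly_c_name : bounds.

Lemma poly_c_outer : poly_bounded c_outer.
Proof. rewrite /c_outer; poly. Qed.
#[local] Hint Resolve poly_c_outer : bounds.

Lemma poly_c_var : poly_bounded c_var.
Proof. rewrite /c_var; poly. Qed.
#[local] Hint Resolve poly_c_var : bounds.

Lemma poly_c_clause : poly_bounded c_clause.
Proof. rewrite /c_clause; poly. Qed.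
#[local] Hint Resolve poly_c_clause : bounds.

Lemma fpt_c_assigns : fpt_bounded c_assigns.
Proof. rewrite /c_assigns; fpt. Qed.
#[local] Hint Resolve fpt_c_assigns : bounds.

Lemma fpt_c_names : fpt_bounded c_names.
Proof. rewrite /c_names; fpt. Qed.
#[local] Hint Resolve fpt_c_names : bounds.

Lemma fpt_c_leaf_cls : fpt_bounded c_leaf_cls.
Proof. rewrite /c_leaf_cls; fpt. Qed.
#[local] Hint Resolve fpt_c_leaf_cls : bounds.

Lemma fpt_c_join_cls : fpt_bounded c_join_cls.
Proof. rewrite /c_join_cls; fpt. Qed.
#[local] Hint Resolve fpt_c_join_cls : bounds.

Lemma fpt_c_node : fpt_bounded c_node.
Proof. rewrite /c_node /c_leaf /c_join; fpt. Qed.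
#[local] Hint Resolve fpt_c_node : bounds.

Lemma fpt_total : fpt_bounded (fun M K => c_main M K + c_output M K).
Proof. rewrite /c_main /c_output; fpt. Qed.

Theorem lemma8 :
  exists (P : program) (c d : nat),
  forall (pre : seq block) (S1 S2 : seq var) (psi : matrix) (T : bagtree)
         (k : nat),
    let phi := QBF (pre ++ [:: (Exists, S1); (Forall, S2)]) psi in
    let n := data_size (enc_instance phi T) in
    qbf_wf phi ->
    tree_decomposition (primal_graph phi) T ->
    width T = k ->
    exists (S1' : seq var) (psi' : matrix) (T' : bagtree),
      let phi' := QBF (pre ++ [:: (Exists, S1')]) psi' in
      [/\ qbf_wf phi',
          tree_decomposition (primal_graph phi') T',
          width T' <= 12 * 2 ^ k,
          outputs_in_time P (enc_instance phi T) (enc_instance phi' T')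
            (c * n ^ d * 2 ^ k)
        & qbf_valid phi <-> qbf_valid phi'].
Proof.
(* With [M = 20 * n] all size hypotheses of [fn_main] hold; the most demanding one is the factor 12
   for bags. *)
have [c [d Hcd]] := fpt_scale fpt_total (isT : 0 < 20).
(* A bag of width [k] has up to [2 ^ (k + 1)] assignments, whence the factor 2. *)
exists prog, (2 * c), d => pre S1 S2 psi T k phi n phi_wf T_td wT.
pose F := flatten (outer pre S1); pose t := bin_of T.
exists (S1 ++ aux F t [::]), (new_matrix pre S1 psi T), (new_tree pre S1 T).
rewrite -/(reduct pre S1 psi T) => phi'.
have en : n = ((data_size (enc_seq enc_block (qbf_prefix phi)) +
    data_size (enc_matrix psi)).+1 + data_size (enc_bagtree T)).+1 by [].
have n0 : 0 < n by rewrite en.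
have pre_le : data_size (enc_seq enc_block (qbf_prefix phi)) <= 20 * n by lia.
have psi_le : data_size (enc_matrix psi) <= 20 * n by lia.
have bags_le : {in bbags t, forall b, 12 * data_size (enc_vars b) <= 20 * n}.
  by move=> b; rewrite bbags_bin_of => /data_size_bag; lia.
have bags_K : small_bags (2 ^ k.+1) t by rewrite -wT; exact: small_bags_width.
have F_le : size F + 2 * bin_size t + 4 <= 20 * n.
  have := size_flatten_vars (outer pre S1); have := data_size_outer pre S1 S2.
  have := bin_size_le T; rewrite -/t -/F; move: en; rewrite /=; lia.
split.
- exact: reduct_wf phi_wf T_td.
- exact: reduct_td T_td.
- by rewrite -wT; exact: reduct_width.
- have [s Hs sle] := fn_main pre_le psi_le bags_le bags_K F_le.
  exists s => //.
  have out_le := data_size_output pre_le psi_le bags_le bags_K F_le (td_uniq T_td).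
  apply: leq_trans (leq_add sle out_le) _.
  apply: leq_trans (Hcd n (2 ^ k.+1) n0 _) _; first by rewrite expn_gt0.
  by rewrite expnS mulnCA !mulnA.
- exact: reduct_valid phi_wf T_td.
Qed.
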